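(* Let $K$ be a convex body in $\mathbb{R}^n$ such that $0$ is the center of the Löwner ellipsoid of $K$. Then $$(L(\mathbf{1}_K))^\circ=J((\mathbf{1}_K)^\circ).$$
   Context: A convex body is a compact convex set with nonempty interior; $\mathbf{1}_K$ is the characteristic function of $K$. The Löwner ellipsoid of $K$ is the unique ellipsoid of minimal volume containing $K$. A log-concave function is $f=e^{-\psi}$ with $\psi:\mathbb{R}^n\to\mathbb{R}\cup\{\infty\}$ convex; it is nondegenerate if $\mathrm{int}(\mathrm{supp} f)\ne\emptyset$. The polar of a log-concave $f=e^{-\psi}$ is $f^\circ(y)=\inf_{x:\,f(x)>0}\frac{e^{-\langle x,y\rangle}}{f(x)}=e^{-\mathcal{L}\psi(y)}$, where $\mathcal{L}\psi(y)=\sup_{x\in\mathbb{R}^n}[\langle x,y\rangle-\psi(x)]$. Löwner function: for a nondegenerate integrable log-concave $f=e^{-\psi}$, $L(f)(x)=e^{-\|A_0x\|_2+t_0}$, where $(A_0,t_0)$ minimizes $\int_{\mathbb{R}^n}e^{-\|Ax\|_2+t}dx$ over all $t\in\mathbb{R}$ and invertible affine maps $A$ of $\mathbb{R}^n$ subject to $\|Ax\|_2-t\le\psi(x)$ for all $x$; such a minimizer exists, with $t_0$ unique and $A_0$ unique up to left multiplication by an orthogonal matrix. John function: for a nondegenerate integrable log-concave $f$, $J(f)=s_0\mathbf{1}_{A_0B_2^n}$, where $(s_0,A_0)$ maximizes $s|\det A|$ over all $0<s\le\|f\|_\infty$ and all invertible affine maps $A$ of $\mathbb{R}^n$ (with $\det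 A$ the determinant of the linear part) subject to $s\mathbf{1}_{AB_2^n}\le f$; the maximizer for the functions considered here exists, with $s_0$ unique and $A_0$ unique up to right orthogonal transformations. $B_2^n$ is the closed Euclidean unit ball. *)

(* Defs.v *)
(* R^n is 'cV[R]_n over an arbitrary R : realType (MathComp-Analysis). *)
From HB Require Import structures.
From mathcomp Require Import all_boot all_order all_algebra.
From mathcomp Require Import all_classical all_reals all_analysis.

Set Implicit Arguments.
Unset Strict Implicit.
Unset Printing Implicit Defensive.

Import Order.TTheory GRing.Theory Num.Theory.
Import numFieldNormedType.Exports.

Local Open Scope classical_set_scope.
Local Open Scope ring_scope.

Section power_measure.
Context d (T : measurableType d) (R : realType).

Definition tcons n (p : T * n.-tuple T) : n.+1.-tuple T :=
  [the n.+1.-tuple T of p.1 :: p.2].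

Lemma measurable_tcons n : measurable_fun setT (@tcons n).
Proof. exact: (measurable_cons measurable_fst measurable_snd). Qed.

Variable m : {sigma_finite_measure set T -> \bar R}.

Section step.
Variables (n : nat) (mu : {sigma_finite_measure set (n.-tuple T) -> \bar R}).

Definition tcons_measure : set (n.+1.-tuple T) -> \bar R :=
  pushforward (m \x mu)%E (@tcons n).

Let tcons_measure0 : tcons_measure set0 = 0%E.
Proof. by rewrite /tcons_measure /pushforward preimage_set0 measure0. Qed.

Let tcons_measure_ge0 A : (0 <= tcons_measure A)%E.
Proof. by rewrite /tcons_measure /pushforward measure_ge0. Qed.

Let tcons_measure_sigma_additive : semi_sigma_additive tcons_measure.
Proof.
move=> F mF tF mUF; rewrite /tcons_measure /pushforward preimage_bigcup.
have mt := @measurable_tcons n.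
apply: measure_semi_sigma_additive.
- by move=> k; rewrite -[X in measurable X]setTI; exact: mt.
- apply/trivIsetP => /= i j _ _ ij; rewrite -preimage_setI.
  by move/trivIsetP : tF => /(_ _ _ _ _ ij) ->//; rewrite preimage_set0.
- by rewrite -preimage_bigcup -[X in measurable X]setTI; exact: mt.
Qed.

HB.instance Definition _ := isMeasure.Build _ _ _ tcons_measure
  tcons_measure0 tcons_measure_ge0 tcons_measure_sigma_additive.

Let tcons_measure_sigma_finite : sigma_finite setT tcons_measure.
Proof.
have /sigma_finiteP[F [FT ndF Ffin]] := sigma_finiteT m.
have /sigma_finiteP[G [GT ndG Gfin]] := sigma_finiteT mu.
pose tuncons (t : n.+1.-tuple T) := (thead t, [tuple of behead t]).
have tconsK : cancel (@tcons n) tuncons.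
  by case=> x t; congr pair; exact: val_inj.
have mtuncons : measurable_fun setT tuncons.
  by apply: measurable_fun_pair; [exact: measurable_tnth
                                 |exact: measurable_behead].
exists (fun k => tuncons @^-1` (F k `*` G k)).
  rewrite -preimage_bigcup (_ : \bigcup_k _ = setT) ?preimage_setT//.
  apply/seteqP; split=> // -[x t] _.
  have [i _ Fix] : (\bigcup_i F i) x by rewrite -FT.
  have [j _ Gjt] : (\bigcup_j G j) t by rewrite -GT.
  exists (maxn i j) => //; split=> /=.
  - by move: x Fix; exact/subsetPset/ndF/leq_maxl.
  - by move: t Gjt; exact/subsetPset/ndG/leq_maxr.
move=> k; have [mFk Fk] := Ffin k; have [mGk Gk] := Gfin k; split.
  by rewrite -[X in measurable X]setTI; apply: mtuncons => //;
    exact: measurableX.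
rewrite /tcons_measure /pushforward -comp_preimage.
rewrite (_ : tuncons \o _ = id); last first.
  by apply/funext => p /=; rewrite tconsK.
by rewrite preimage_id product_measure1E// lte_mul_pinfty// ge0_fin_numE.
Qed.

HB.instance Definition _ :=
  Measure_isSigmaFinite.Build _ _ _ tcons_measure tcons_measure_sigma_finite.

End step.

(* n-fold product of m, along T * n.-tuple T ~ n.+1.-tuple T *)
Fixpoint power_measure n : {sigma_finite_measure set (n.-tuple T) -> \bar R} :=
  match n with
  | 0%N => dirac ([tuple] : 0.-tuple T)
  | k.+1 => tcons_measure (power_measure k)
  end.

End power_measure.

Section euclidean.
Context (R : realType) (n : nat).
Implicit Types (x y c : 'cV[R]_n) (K E : set 'cV[R]_n).

Definition dotv x y : R := \sum_(i < n) x i 0 * y i 0.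

(* The library norm `|x| on 'cV[R]_n is the maximum norm. *)
Definition enorm x : R := Num.sqrt (dotv x x).

Definition eball : set 'cV[R]_n := [set x | enorm x <= 1].

Definition lebesgue_tuple :
    {sigma_finite_measure set (n.-tuple (measurableTypeR R)) -> \bar R} :=
  power_measure lebesgue_measure n.

(* The product sigma-algebra lives on tuples; it is moved to 'cV[R]_n through
   this bijection. *)
Definition vec_of_tuple (t : n.-tuple (measurableTypeR R)) : 'cV[R]_n :=
  \col_i tnth t i.

Definition integralRn (f : 'cV[R]_n -> R) : \bar R :=
  (\int[lebesgue_tuple]_t (f (vec_of_tuple t))%:E)%E.

Definition volume (E : set 'cV[R]_n) : \bar R :=
  lebesgue_tuple (vec_of_tuple @^-1` E).

Definition convex_body K :=
  [/\ compact K, convex_set (K : set (convex_lmodType 'cV[R]_n))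
    & K° !=set0].

Record affine_map := AffineMap {
  linpart : 'M[R]_n ;
  offset : 'cV[R]_n
}.

Definition affine_app (A : affine_map) x := linpart A *m x + offset A.
Coercion affine_app : affine_map >-> Funclass.

Definition affine_invertible (A : affine_map) : Prop := linpart A \in unitmx.

Definition ellipsoid_of_center c E :=
  exists A : affine_map, [/\ affine_invertible A, A 0 = c & E = A @` eball].

Definition ellipsoid E := exists c, ellipsoid_of_center c E.

(* Every convex body K has exactly one such E; uniqueness is a consequence of
   minimality and is not part of the predicate. *)
Definition lowner_ellipsoid K E :=
  [/\ ellipsoid E, K `<=` E &
    forall E', ellipsoid E' -> K `<=` E' -> (volume E <= volume E')%E].

End euclidean.

Section functional.
Context (R : realType) (n : nat).
Implicit Types (f g h : 'cV[R]_n -> R) (A : affine_map R n).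

(* psi with f = e^(-psi); +oo where f vanishes *)
Definition potential f (x : 'cV[R]_n) : \bar R := (- lne (f x)%:E)%E.

(* The infimum over the empty set, i.e., for f = 0, is 0 here and not +oo. *)
Definition polar f (y : 'cV[R]_n) : R :=
  inf [set expR (- dotv x y) / f x | x in [set x | 0 < f x]].

Definition exp_norm A (t : R) (x : 'cV[R]_n) : R := expR (- enorm (A x) + t).

Definition lowner_feasible f A (t : R) :=
  affine_invertible A /\ forall x, ((enorm (A x) - t)%:E <= potential f x)%E.

Definition lowner_minimizer f A (t : R) :=
  lowner_feasible f A t /\
  forall A' t', lowner_feasible f A' t' ->
    (integralRn (exp_norm A t) <= integralRn (exp_norm A' t'))%E.

Definition sup_norm f : \bar R := ereal_sup (range (fun x => `|f x|%:E)).

Definition scaled_indic (s : R) A (x : 'cV[R]_n) : R :=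
  s * \1_(A @` @eball R n) x.

Definition john_feasible f (s : R) A :=
  [/\ 0 < s, (s%:E <= sup_norm f)%E, affine_invertible A
    & forall x, scaled_indic s A x <= f x].

Definition john_maximizer f (s : R) A :=
  john_feasible f s A /\
  forall s' A', john_feasible f s' A' ->
    s' * `|\det (linpart A')| <= s * `|\det (linpart A)|.

(* For nondegenerate integrable log-concave f, optimizers are unique up to
   orthogonal transformations, so the chosen function does not depend on the
   optimizer. Without optimizer, lowner_fun f = 0 and john_fun f = -1. Since
   polar 0 = 0, polar g >= 0 and 0 < s in john_maximizer, an equality
   polar (lowner_fun f) = john_fun g entails that both optimizers exist. *)
Definition lowner_fun f : 'cV[R]_n -> R :=
  xget (fun=> 0)
    [set g | exists A t, lowner_minimizer f A t /\ g = exp_norm A t].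

Definition john_fun f : 'cV[R]_n -> R :=
  xget (fun=> -1)
    [set h | exists s A, john_maximizer f s A /\ h = scaled_indic s A].

End functional.

(* Main.v *)
Require Import Defs.
From mathcomp Require Import all_boot all_order all_algebra.
From mathcomp Require Import all_classical all_reals all_analysis.
From mathcomp Require Import measurable_realfun.
From mathcomp Require Import ring lra.

Set Implicit Arguments.
Unset Strict Implicit.
Unset Printing Implicit Defensive.

Import Order.TTheory GRing.Theory Num.Theory.
Import numFieldNormedType.Exports.

Local Open Scope classical_set_scope.
Local Open Scope ring_scope.

(** Write the Loewner ellipsoid of [K] as [L B], [B] the unit ball, and
    [u = L^-1 x].  The first-order condition of minimality is: if a quadratic
    function [<u, G u> + <b, u>] is at most [t] on [L^-1 K], then
    [tr G <= n t].  Indeed, for small [e] the set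
    [|u + e (G u + b) / 2|^2 <= 1 + e t + O(e^2)] is an ellipsoid containing
    [L^-1 K], so its volume is at least that of [B].  This replaces John's
    decomposition of the identity.

    A constraint [|M u + b| <= t] (Loewner function of the indicator of [K]) or
    [|M u| + <b, u> <= t] (John function of its polar) yields, through
    Cauchy-Schwarz, the hypothesis of this condition for [G = C M], [C] any
    contraction; hence [tr (C M) <= n t].  Choosing [C] such that [C M] is
    triangular, the arithmetic-geometric mean inequality gives
    [|det M| <= t^n <= e^(t - n) n^n].  This bounds both optimization problems
    by the same constant.  In the equality case [t = n], [M] is [n] times an
    isometry and [b = 0], so that the optimizers are unique: they are
    [e^(- n |u| + n)] and [e^(- n)] on the ball of radius [n] of the dual norm,
    which are polar to each other. *)

(** * Linear change of variables *)

Section change_of_variables.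
Context (R : realType).
Local Notation mu := (@lebesgue_measure R).
Implicit Types (a b : R).

Definition affine1 a b (x : measurableTypeR R) : measurableTypeR R := a * x + b.

Lemma measurable_affine1 a b : measurable_fun setT (affine1 a b).
Proof. by apply: measurable_funD => //; apply: measurable_funM. Qed.

(** By uniqueness of Lebesgue measure it is enough to compare both sides on the intervals []c, d]].
    Their preimages are intervals, with the closed end on the left when [a < 0]. *)
Lemma lebesgue_measure_affine a b (A : set (measurableTypeR R)) :
  a != 0 -> measurable A -> (`|a|%:E * mu (affine1 a b @^-1` A) = mu A)%E.
Proof.
move=> a0 mA.
pose m := measure_function_pushforward__canonical__measure_function_Measure
  mu (measurable_affine1 a b).
apply/esym/(@lebesgue_measure_unique _ (mscale (NngNum (normr_ge0 a)) m)) => //.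
move=> _ [[c d]] _ <-.
change (mu `]c, d] = `|a|%:E * mu (affine1 a b @^-1` `]c, d]))%E.
have [apos|aneg] := ltP 0 a.
  rewrite (_ : _ @^-1` _ = `](c - b) / a, (d - b) / a]%classic); last first.
    apply/seteqP; split => x /=; rewrite !in_itv/= /affine1 ltr_pdivrMr//
      ler_pdivlMr//; move=> /andP[h1 h2]; apply/andP; split; lra.
  rewrite !lebesgue_measure_itv/= !lte_fin ltr_pM2r ?invr_gt0// ltrD2r.
  case: ifP => _; last by rewrite mule0.
  by rewrite -!EFinB -EFinM gtr0_norm//; congr EFin; field.
have {}aneg : a < 0 by rewrite lt_neqAle a0.
rewrite (_ : _ @^-1` _ = `[(d - b) / a, (c - b) / a[%classic); last first.
  apply/seteqP; split => x /=; rewrite !in_itv/= /affine1 ltr_ndivlMr//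
    ler_ndivrMr//; move=> /andP[h1 h2]; apply/andP; split; lra.
rewrite !lebesgue_measure_itv/= !lte_fin ltr_nM2r ?invr_lt0// ltrD2r.
case: ifP => _; last by rewrite mule0.
by rewrite -!EFinB -EFinM ltr0_norm//; congr EFin; field.
Qed.

Lemma ge0_integral_affine1 a b (f : measurableTypeR R -> \bar R) :
  a != 0 -> measurable_fun setT f -> (forall x, 0 <= f x)%E ->
  (`|a|%:E * \int[mu]_x f (affine1 a b x) = \int[mu]_x f x)%E.
Proof.
move=> a0 mf f0.
have mA := measurable_affine1 a b.
pose m := measure_function_pushforward__canonical__measure_function_Measure mu mA.
pose k := NngNum (normr_ge0 a).
transitivity (\int[mscale k m]_x f x)%E.
  by rewrite ge0_integral_mscale// ge0_integral_pushforward.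
apply: eq_measure_integral => // A mA' _.
exact: lebesgue_measure_affine.
Qed.

(** Column counterpart of [tcons]; the body is typed in dimension [1 + n] so that the block-matrix
    calculus applies. *)
Definition vcons n (x : R) (v : 'cV[R]_n) : 'cV[R]_n.+1 :=
  col_mx x%:M v : 'cV_(1 + n).

Lemma vec_of_tcons n (x : measurableTypeR R) (t : n.-tuple (measurableTypeR R)) :
  vec_of_tuple (tcons (x, t)) = vcons x (vec_of_tuple t).
Proof.
apply/colP => i; rewrite mxE; case: (split_ordP (i : 'I_(1 + n))) => j ->.
  rewrite [RHS]col_mxEu ord1 mxE eqxx mulr1n.
  have -> : lshift n 0 = (ord0 : 'I_(1 + n)) by exact: val_inj.
  by [].
rewrite [RHS]col_mxEd mxE.
have -> : rshift 1 j = (lift ord0 j : 'I_(1 + n)) by exact: val_inj.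
exact: tnthS.
Qed.

Definition vmeasurable n (F : 'cV[R]_n -> \bar R) :=
  measurable_fun setT (F \o @vec_of_tuple R n).

(** Unlike for [integralRn], the integrand has extended values, since the partial integrals in
    Tonelli's theorem may be infinite. *)
Definition vintegral n (F : 'cV[R]_n -> \bar R) : \bar R :=
  (\int[lebesgue_tuple R n]_t F (vec_of_tuple t))%E.

Lemma measurable_tuple_of_vec n d (T : measurableType d) (g : T -> 'cV[R]_n) :
  (forall i, measurable_fun setT (fun t => g t i 0 : measurableTypeR R)) ->
  measurable_fun setT
    (fun t => [tuple g t i 0 | i < n] : n.-tuple (measurableTypeR R)).
Proof.
move=> mg; apply/measurable_fun_tnthP => i.
rewrite (_ : _ \o _ = (fun t => g t i 0))//.
by apply/funext => t /=; rewrite tnth_mktuple.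
Qed.

Lemma vmeasurable_comp n (F : 'cV[R]_n -> \bar R) d (T : measurableType d)
    (g : T -> 'cV[R]_n) : vmeasurable F ->
  (forall i, measurable_fun setT (fun t => g t i 0 : measurableTypeR R)) ->
  measurable_fun setT (F \o g).
Proof.
move=> mF mg.
rewrite (_ : F \o g = (F \o @vec_of_tuple R n) \o
  (fun t => [tuple g t i 0 | i < n] : n.-tuple (measurableTypeR R))).
  exact: measurableT_comp (measurable_tuple_of_vec mg).
apply/funext => t /=; congr F.
by apply/colP => i; rewrite mxE tnth_mktuple.
Qed.

Lemma measurable_vec_of_tuple n (i : 'I_n) :
  measurable_fun setT (fun t => @vec_of_tuple R n t i 0 : measurableTypeR R).
Proof.
rewrite (_ : (fun _ => _) = @tnth _ _ ^~ i); first exact: measurable_tnth.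
by apply/funext => t; rewrite mxE.
Qed.

Lemma measurable_mulmx n m (M : 'M[R]_(m, n)) (b : 'cV_m) d (T : measurableType d)
    (g : T -> 'cV[R]_n) i :
  (forall i, measurable_fun setT (fun t => g t i 0 : measurableTypeR R)) ->
  measurable_fun setT (fun t => (M *m g t + b) i 0 : measurableTypeR R).
Proof.
move=> mg.
rewrite (_ : (fun _ => _) = (fun t => \sum_j M i j * g t j 0 + b i 0)).
  apply: measurable_funD => //; apply: measurable_sum => j.
  by apply: measurable_funM; [exact: measurable_cst|exact: mg].
by apply/funext => t; rewrite !mxE.
Qed.

Lemma vmeasurable_affine n m (F : 'cV[R]_m -> \bar R) (M : 'M[R]_(m, n)) (b : 'cV_m) :
  vmeasurable F -> vmeasurable (fun x => F (M *m x + b)).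
Proof.
move=> mF; apply: (vmeasurable_comp (g := fun t => M *m vec_of_tuple t + b) mF) => i.
by apply: measurable_mulmx => j; exact: measurable_vec_of_tuple.
Qed.

Lemma measurable_vcons n d (T : measurableType d) (f : T -> measurableTypeR R)
    (g : T -> 'cV[R]_n) :
  measurable_fun setT f ->
  (forall i, measurable_fun setT (fun t => g t i 0 : measurableTypeR R)) ->
  forall i, measurable_fun setT (fun t => vcons (f t) (g t) i 0 : measurableTypeR R).
Proof.
move=> mf mg i; case: (split_ordP (i : 'I_(1 + n))) => j ->.
  rewrite [X in measurable_fun _ X](_ : _ = f)//; apply/funext => t.
  by rewrite [LHS]col_mxEu ord1 mxE eqxx.
rewrite [X in measurable_fun _ X](_ : _ = (fun t => g t j 0))//.
by apply/funext => t; rewrite [LHS]col_mxEd.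
Qed.

Lemma measurable_fun_vcons n (F : 'cV[R]_n.+1 -> \bar R) :
  vmeasurable F ->
  measurable_fun setT
    (fun p : measurableTypeR R * n.-tuple (measurableTypeR R) =>
      F (vcons p.1 (vec_of_tuple p.2))).
Proof.
move=> mF.
apply: (vmeasurable_comp
  (g := fun p : measurableTypeR R * n.-tuple (measurableTypeR R) =>
    vcons p.1 (vec_of_tuple p.2)) mF).
apply: measurable_vcons => // i.
exact: measurableT_comp (measurable_vec_of_tuple i) measurable_snd.
Qed.

Lemma vintegral_vcons n (F : 'cV[R]_n.+1 -> \bar R) : vmeasurable F ->
  (forall x, 0 <= F x)%E ->
  vintegral F = (\int[mu]_x vintegral (fun v => F (vcons x v)))%E.
Proof.
move=> mF F0; rewrite /vintegral.
have mt := @measurable_tcons _ (measurableTypeR R) n.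
transitivity (\int[pushforward (mu \x lebesgue_tuple R n)%E
    (@tcons _ (measurableTypeR R) n)]_t (F \o @vec_of_tuple R n.+1) t)%E; first by [].
rewrite ge0_integral_pushforward;
  [|exact: mt|exact: measurableT|exact: mF|by move=> y _; exact: F0].
rewrite preimage_setT.
transitivity (\int[(mu \x lebesgue_tuple R n)]_p
  F (vcons p.1 (vec_of_tuple p.2)))%E.
  by apply: eq_integral => -[x t] _ /=; rewrite vec_of_tcons.
rewrite (fubini_tonelli1
  (fun p : measurableTypeR R * n.-tuple (measurableTypeR R) =>
    F (vcons p.1 (vec_of_tuple p.2))))//.
exact: measurable_fun_vcons.
Qed.

(** Tonelli's theorem with the first coordinate innermost, the order suited to upper block
    triangular matrices. *)
Lemma vintegral_vcons_swap n (F : 'cV[R]_n.+1 -> \bar R) : vmeasurable F ->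
  (forall x, 0 <= F x)%E ->
  vintegral F = vintegral (fun v => \int[mu]_x F (vcons x v))%E.
Proof.
move=> mF F0; rewrite vintegral_vcons// /vintegral.
rewrite (fubini_tonelli
  (fun p : measurableTypeR R * n.-tuple (measurableTypeR R) =>
    F (vcons p.1 (vec_of_tuple p.2))))//.
exact: measurable_fun_vcons.
Qed.

Lemma vmeasurable_vcons n (F : 'cV[R]_n.+1 -> \bar R) x : vmeasurable F ->
  vmeasurable (fun v => F (vcons x v)).
Proof.
move=> mF; apply: (vmeasurable_comp (g := fun t => vcons x (vec_of_tuple t)) mF).
by apply: measurable_vcons => // i; exact: measurable_vec_of_tuple.
Qed.

Lemma measurable_vconsl n (F : 'cV[R]_n.+1 -> \bar R) v : vmeasurable F ->
  measurable_fun setT (fun x : measurableTypeR R => F (vcons x v)).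
Proof.
move=> mF; apply: (vmeasurable_comp (g := fun x : measurableTypeR R => vcons x v) mF).
exact: measurable_vcons.
Qed.

Lemma measurable_vintegral_vcons n (F : 'cV[R]_n.+1 -> \bar R) : vmeasurable F ->
  (forall x, 0 <= F x)%E ->
  measurable_fun setT
    (fun x : measurableTypeR R => vintegral (fun v => F (vcons x v))).
Proof.
move=> mF F0.
exact: (measurable_fun_fubini_tonelli_F
  (fun p : measurableTypeR R * n.-tuple (measurableTypeR R) =>
    F (vcons p.1 (vec_of_tuple p.2)))
  (measurable_fun_vcons mF)).
Qed.

Lemma vmeasurable_integral_vcons n (F : 'cV[R]_n.+1 -> \bar R) : vmeasurable F ->
  (forall x, 0 <= F x)%E ->
  vmeasurable (fun v => \int[mu]_x F (vcons x v))%E.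
Proof.
move=> mF F0.
exact: (measurable_fun_fubini_tonelli_G
  (fun p : measurableTypeR R * n.-tuple (measurableTypeR R) =>
    F (vcons p.1 (vec_of_tuple p.2)))
  (measurable_fun_vcons mF)).
Qed.

Lemma vintegral_ge0 n (F : 'cV[R]_n -> \bar R) : (forall x, 0 <= F x)%E ->
  (0 <= vintegral F)%E.
Proof. by move=> F0; apply: integral_ge0 => *. Qed.

Lemma eq_vintegral n (F G : 'cV[R]_n -> \bar R) : F =1 G ->
  vintegral F = vintegral G.
Proof. by move=> FG; apply: eq_integral => t _; rewrite FG. Qed.

Lemma vintegralZl n (F : 'cV[R]_n -> \bar R) (k : R) : vmeasurable F ->
  (forall x, 0 <= F x)%E -> 0 <= k ->
  vintegral (fun x => k%:E * F x)%E = (k%:E * vintegral F)%E.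
Proof. by move=> mF F0 k0; exact: ge0_integralZl_EFin. Qed.

(** The translation [b] makes the induction work: once one group of coordinates is fixed, the
    off-diagonal block of a triangular matrix acts as a translation. *)
Definition scales_integral n (M : 'M[R]_n) :=
  forall (b : 'cV[R]_n) (F : 'cV[R]_n -> \bar R),
  vmeasurable F -> (forall x, 0 <= F x)%E ->
  (`|\det M|%:E * vintegral (fun x => F (M *m x + b)%R) = vintegral F)%E.

Lemma scales_integralM n (M N : 'M[R]_n) :
  scales_integral M -> scales_integral N -> scales_integral (M *m N).
Proof.
move=> hM hN b F mF F0.
rewrite det_mulmx normrM EFinM -muleA.
under eq_vintegral => x.
  rewrite -mulmxA -[in X in F (X + _)%R](addr0 (N *m x)).
  over.
rewrite (hN 0 (fun x => F (M *m x + b)%R))//; first exact: hM.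
exact: vmeasurable_affine.
Qed.

Let blk n (a : R) (w : 'rV[R]_n) (v : 'cV[R]_n) (S : 'M[R]_n) : 'M[R]_n.+1 :=
  block_mx a%:M w v S : 'M[R]_(1 + n).

Lemma mul_block_vcons n (a : R) (w : 'rV[R]_n) (v : 'cV[R]_n) (S : 'M[R]_n) x y :
  blk a w v S *m vcons x y = vcons (a * x + (w *m y) 0 0) (x *: v + S *m y).
Proof.
rewrite [LHS](mul_block_col a%:M w v S x%:M y).
congr (col_mx _ _ : 'cV_(1 + n)).
  by rewrite -scalar_mxM [X in _ + X]mx11_scalar raddfD.
by rewrite mul_mx_scalar.
Qed.

Lemma vconsD n x x' (y y' : 'cV[R]_n) :
  vcons x y + vcons x' y' = vcons (x + x') (y + y').
Proof. by rewrite [LHS](add_col_mx x%:M y x'%:M y') /vcons raddfD. Qed.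

Lemma vcons_surj n (b : 'cV[R]_n.+1) : exists x y, b = vcons x y.
Proof.
exists ((usubmx (b : 'cV_(1 + n))) 0 0), (dsubmx (b : 'cV_(1 + n))).
by rewrite /vcons -mx11_scalar vsubmxK.
Qed.

Let det_lblk n (a : R) (v : 'cV[R]_n) (S : 'M[R]_n) :
  \det (blk a 0 v S) = a * \det S.
Proof. by rewrite [LHS](det_lblock a%:M v S) det_scalar1. Qed.

Let det_ublk n (a : R) (w : 'rV[R]_n) (S : 'M[R]_n) :
  \det (blk a w 0 S) = a * \det S.
Proof. by rewrite [LHS](det_ublock a%:M w S) det_scalar1. Qed.

(** For a fixed first coordinate [x], the column [v] only translates the others by [x *: v]; the
    inner integral yields the factor of [S], the outer one that of [a]. *)
Lemma scales_integral_lblock n (a : R) (v : 'cV[R]_n) (S : 'M[R]_n) :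
  a != 0 -> scales_integral S -> scales_integral (blk a 0 v S).
Proof.
move=> a0 hS b F mF F0; have [b1 [b2 ->]] := vcons_surj b.
rewrite det_lblk normrM EFinM -muleA.
have mF' := vmeasurable_affine (blk a 0 v S) (vcons b1 b2) mF.
rewrite vintegral_vcons// -ge0_integralZl_EFin//; last 2 first.
- by move=> x _; exact: vintegral_ge0.
- exact: (measurable_vintegral_vcons mF').
under eq_integral => x _.
  under eq_vintegral => y.
    rewrite mul_block_vcons mul0mx mxE addr0 vconsD -addrA addrCA.
    over.
  rewrite (hS _ (fun y => F (vcons (a * x + b1) y)))//; last first.
    exact: vmeasurable_vcons.
  over.
rewrite (@ge0_integral_affine1 a b1 (fun x => vintegral (fun y => F (vcons x y))))//.
- by rewrite vintegral_vcons.
- exact: measurable_vintegral_vcons.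
- by move=> x; exact: vintegral_ge0.
Qed.

(** Symmetric to the lower case: for fixed last coordinates [y], the row [w] only translates the
    first one by [w *m y]. *)
Lemma scales_integral_ublock n (a : R) (w : 'rV[R]_n) (S : 'M[R]_n) :
  a != 0 -> scales_integral S -> scales_integral (blk a w 0 S).
Proof.
move=> a0 hS b F mF F0; have [b1 [b2 ->]] := vcons_surj b.
rewrite det_ublk mulrC normrM EFinM -muleA.
have mF' := vmeasurable_affine (blk a w 0 S) (vcons b1 b2) mF.
rewrite vintegral_vcons_swap// -vintegralZl//; last 2 first.
- exact: (vmeasurable_integral_vcons mF').
- by move=> y; exact: integral_ge0.
under eq_vintegral => y.
  under eq_integral => x _.
    rewrite mul_block_vcons scaler0 add0r vconsD -addrA.
    over.
  rewrite (@ge0_integral_affine1 a _ (fun x => F (vcons x (S *m y + b2))))//; last first.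
    exact: measurable_vconsl.
  over.
rewrite (hS b2 (fun y => \int[mu]_x F (vcons x y))%E)//.
- by rewrite -vintegral_vcons_swap.
- exact: vmeasurable_integral_vcons.
- by move=> x; exact: integral_ge0.
Qed.

(* After a shear making the (0, 0) entry nonzero, a block LU step splits the
   matrix into block triangular factors, which Tonelli's theorem handles in one
   order of integration or the other. *)
Lemma vintegral_affine n (M : 'M[R]_n) : M \in unitmx -> scales_integral M.
Proof.
elim: n M => [|n IH] M uM.
  move=> b F _ _; rewrite det_mx00 normr1 mul1e.
  by apply: eq_vintegral => x; congr F; by rewrite [LHS]flatmx0 [RHS]flatmx0.
have h1 : @scales_integral n 1%:M by apply: IH; exact: unitmx1.
have pivot (N : 'M[R]_(1 + n)) : N 0 0 != 0 -> N \in unitmx ->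
    @scales_integral n.+1 N.
  move=> N0 uN.
  (* [S] is the Schur complement of the pivot [N 0 0]. *)
  pose v := (N 0 0)^-1 *: dlsubmx N; pose S := drsubmx N - v *m ursubmx N.
  have e : N = (blk 1 0 v 1%:M : 'M[R]_(1 + n)) *m blk (N 0 0) (ursubmx N) 0 S.
    rewrite [RHS](mulmx_block 1%:M 0 v 1%:M (N 0 0)%:M (ursubmx N) 0 S).
    rewrite !mul1mx !mul0mx !addr0 mul_mx_scalar scalerA divff// scale1r.
    rewrite addrC subrK -[LHS]submxK; congr block_mx.
    by rewrite [LHS]mx11_scalar !mxE; congr (N _ _)%:M; exact: val_inj.
  rewrite e; apply: scales_integralM; first exact: scales_integral_lblock.
  apply: scales_integral_ublock => //; apply: IH.
  move: uN; rewrite e unitmx_mul => /andP[_].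
  by rewrite !unitmxE det_ublk unitrM => /andP[].
have [M00|] := eqVneq (M 0 0) 0; last by move=> ?; exact: pivot.
have [i Mi] : exists i : 'I_n, M (lift 0 i) 0 != 0.
  apply/existsP; apply: contraT; rewrite negb_exists => /forallP M0.
  move: uM; rewrite unitmxE (expand_det_col _ 0) big1 ?unitr0// => j _.
  have [->|j0] := eqVneq j 0; first by rewrite M00 mul0r.
  move: j0; rewrite eq_sym => /unlift_some[k -> _].
  by have := M0 k; rewrite negbK => /eqP ->; rewrite mul0r.
(* [E 1] adds row [lift 0 i] to the first row, which makes the pivot equal to [M (lift 0 i) 0];
   [E (-1)] undoes this. *)
pose E c : 'M[R]_n.+1 := blk 1 (c *: delta_mx 0 i) 0 1%:M.
have EK : E (-1) *m E 1 = 1%:M.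
  rewrite [LHS](mulmx_block (1%:M : 'M[R]_1) (-1 *: delta_mx 0 i) 0 1%:M
    1%:M (1 *: delta_mx 0 i) 0 1%:M).
  rewrite !mul1mx !mulmx1 !mul0mx !mulmx0 !addr0 add0r scale1r scaleN1r subrr.
  exact/esym/(@scalar_mx_block _ 1 n).
have uE c : E c \in unitmx.
  by rewrite unitmxE det_ublk det1 mulr1 unitr1.
have -> : M = E (-1) *m (E 1 *m M) by rewrite mulmxA EK mul1mx.
apply: scales_integralM; first exact: scales_integral_ublock.
apply: (pivot (E 1 *m M)); last by rewrite unitmx_mul uE.
rewrite mxE big_ord_recl M00 mulr0 add0r (bigD1 i)//= big1 ?addr0 => [|j ij].
  have -> : E 1 0 (lift 0 i) = 1; last by rewrite mul1r.
  have -> : lift 0 i = rshift 1 i :> 'I_(1 + n) by exact: val_inj.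
  have {1}-> : 0 = lshift n 0 :> 'I_(1 + n) by exact: val_inj.
  by rewrite [LHS](block_mxEur 1%:M) scale1r mxE !eqxx.
have -> : lift 0 j = rshift 1 j :> 'I_(1 + n) by exact: val_inj.
have {1}-> : 0 = lshift n 0 :> 'I_(1 + n) by exact: val_inj.
by rewrite [E _ _ _](block_mxEur 1%:M) scale1r mxE (negbTE ij) andbF mul0r.
Qed.

(** * Measurability of the norm and product integrands *)

Lemma measurable_dotv n d (T : measurableType d) (g h : T -> 'cV[R]_n) :
  (forall i, measurable_fun setT (fun t => g t i 0 : measurableTypeR R)) ->
  (forall i, measurable_fun setT (fun t => h t i 0 : measurableTypeR R)) ->
  measurable_fun setT (fun t => dotv (g t) (h t) : measurableTypeR R).
Proof.
move=> mg mh; apply: measurable_sum => i.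
by apply: measurable_funM; [exact: mg|exact: mh].
Qed.

Lemma vmeasurable_enorm n (phi : R -> R) : measurable_fun setT phi ->
  vmeasurable (fun x : 'cV[R]_n => (phi (enorm x))%:E).
Proof.
move=> mphi; apply/measurable_EFinP; apply: (measurableT_comp mphi).
apply: (measurableT_comp (continuous_measurable_fun (@sqrt_continuous R))).
by apply: measurable_dotv => i; exact: measurable_vec_of_tuple.
Qed.

(** Source of explicit integrals: product integrands bound the rotation-invariant ones, from above
    with exponentials and from below with the indicator of a cube. *)
Lemma vintegral_prod n (g : R -> R) (r : R) : measurable_fun setT g ->
  (forall x, 0 <= g x) -> (\int[mu]_x (g x)%:E = r%:E)%E ->
  vmeasurable (fun v : 'cV[R]_n => (\prod_i g (v i 0))%:E) /\
  vintegral (fun v : 'cV[R]_n => (\prod_i g (v i 0))%:E) = (r ^+ n)%:E.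
Proof.
move=> mg g0 gr.
have mp m : vmeasurable (fun v : 'cV[R]_m => (\prod_i g (v i 0))%:E).
  apply/measurable_EFinP; apply: measurable_prod => i _.
  by apply: measurableT_comp => //; exact: measurable_vec_of_tuple.
split=> //; elim: n => [|n IH].
  rewrite expr0 /vintegral integral_dirac//; last exact: (mp 0%N).
  rewrite [X in (X * _)%E]diracT mul1e/=.
  by rewrite big_ord0.
rewrite vintegral_vcons//; last by move=> x; rewrite lee_fin prodr_ge0.
under eq_integral => x _.
  under eq_vintegral => v.
    rewrite (@big_ord_recl _ _ _ n) EFinM.
    rewrite (eq_bigr (fun i => g (v i 0))) => [|i _]; last first.
      congr g; have -> : lift ord0 i = rshift 1 i :> 'I_(1 + n) by exact: val_inj.
      exact: col_mxEd.
    rewrite (_ : vcons x v ord0 0 = x); last first.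
      have {1}-> : ord0 = lshift n 0 :> 'I_(1 + n) by exact: val_inj.
      by rewrite [LHS]col_mxEu mxE.
    over.
  rewrite vintegralZl//; last by move=> v; rewrite lee_fin prodr_ge0.
  rewrite IH.
  over.
rewrite ge0_integralZr//.
- by rewrite gr -EFinM exprS.
- exact/measurable_EFinP.
- by move=> x _; rewrite lee_fin.
- rewrite lee_fin exprn_ge0// -lee_fin -gr; apply: integral_ge0 => x _.
  by rewrite lee_fin.
Qed.

End change_of_variables.

(** Settles dimension zero, where one cannot divide by [n%:R]. *)
Lemma eq_mx_dim0 (T : Type) m n (A B : 'M[T]_(m, n)) : m = 0%N -> A = B.
Proof. by move=> m0; subst m; apply/matrixP => -[]. Qed.

(** * Volumes and integrals of norms *)

Section enorm.
Context (R : realType) (n : nat).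
Implicit Types (x y z : 'cV[R]_n) (a : R).

Lemma dotvC x y : dotv x y = dotv y x.
Proof. by apply: eq_bigr => i _; rewrite mulrC. Qed.

Lemma dotvDl x y z : dotv (x + y) z = dotv x z + dotv y z.
Proof. by rewrite /dotv -big_split; apply: eq_bigr => i _; rewrite mxE mulrDl. Qed.

Lemma dotvZl a x y : dotv (a *: x) y = a * dotv x y.
Proof. by rewrite /dotv mulr_sumr; apply: eq_bigr => i _; rewrite mxE mulrA. Qed.

Lemma dotvDr x y z : dotv z (x + y) = dotv z x + dotv z y.
Proof. by rewrite !(dotvC z) dotvDl. Qed.

Lemma dotvZr a x y : dotv x (a *: y) = a * dotv x y.
Proof. by rewrite !(dotvC x) dotvZl. Qed.

Lemma dot0v x : dotv 0 x = 0.
Proof. by rewrite /dotv big1// => i _; rewrite mxE mul0r. Qed.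

Lemma dotv0 x : dotv x 0 = 0.
Proof. by rewrite dotvC dot0v. Qed.

Lemma dotNv x y : dotv (- x) y = - dotv x y.
Proof. by rewrite -scaleN1r dotvZl mulN1r. Qed.

Lemma dotvN x y : dotv x (- y) = - dotv x y.
Proof. by rewrite !(dotvC x) dotNv. Qed.

Lemma dotvE x y : dotv x y = (x^T *m y) 0 0.
Proof. by rewrite mxE; apply: eq_bigr => i _; rewrite mxE. Qed.

Lemma dotv_mulmx (A : 'M[R]_n) u v : dotv u (A *m v) = dotv (A^T *m u) v.
Proof. by rewrite !dotvE trmx_mul trmxK mulmxA. Qed.

Lemma dotv_ge0 x : 0 <= dotv x x.
Proof. by apply: sumr_ge0 => i _; rewrite -expr2 sqr_ge0. Qed.

Lemma dotv_eq0 x : (dotv x x == 0) = (x == 0).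
Proof.
apply/eqP/eqP => [/eqP|->]; last exact: dotv0.
rewrite psumr_eq0 => [/allP x0|i _]; last by rewrite -expr2 sqr_ge0.
apply/colP => i; apply/eqP; rewrite mxE -sqrf_eq0 expr2.
exact: (x0 i (mem_index_enum _)).
Qed.

Lemma enorm_ge0 x : 0 <= enorm x.
Proof. exact: sqrtr_ge0. Qed.

Lemma sqr_enorm x : enorm x ^+ 2 = dotv x x.
Proof. by rewrite sqr_sqrtr// dotv_ge0. Qed.

Lemma enorm_eq0 x : (enorm x == 0) = (x == 0).
Proof. by rewrite -sqrf_eq0 sqr_enorm dotv_eq0. Qed.

Lemma enorm0 : enorm (0 : 'cV[R]_n) = 0.
Proof. by apply/eqP; rewrite enorm_eq0. Qed.

Lemma enormZ a x : enorm (a *: x) = `|a| * enorm x.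
Proof. by rewrite /enorm dotvZl dotvZr mulrA -expr2 sqrtrM ?sqr_ge0// sqrtr_sqr. Qed.

Lemma enorm_le x a : 0 <= a -> (enorm x <= a) = (dotv x x <= a ^+ 2).
Proof. by move=> a0; rewrite -sqr_enorm ler_sqr// nnegrE// enorm_ge0. Qed.

Lemma cauchy_schwarz x y : dotv x y <= enorm x * enorm y.
Proof.
have [->|x0] := eqVneq x 0; first by rewrite dot0v enorm0 mul0r.
have [->|y0] := eqVneq y 0; first by rewrite dotv0 enorm0 mulr0.
have xp : 0 < enorm x by rewrite lt_neqAle eq_sym enorm_eq0 x0 enorm_ge0.
have yp : 0 < enorm y by rewrite lt_neqAle eq_sym enorm_eq0 y0 enorm_ge0.
(* Expanding this square gives the inequality multiplied by [enorm x * enorm y], up to a factor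
   2. *)
have := dotv_ge0 (enorm y *: x + (- enorm x) *: y).
rewrite !(dotvDl, dotvDr, dotvZl, dotvZr) (dotvC y x) -!sqr_enorm => h.
rewrite -(ler_pM2l (mulr_gt0 xp yp)); nra.
Qed.

Lemma normr_coord_le x i : `|x i 0| <= enorm x.
Proof.
rewrite -(ler_sqr (normr_ge0 _) (enorm_ge0 _)) real_normK ?num_real//.
rewrite sqr_enorm /dotv (bigD1 i)//= -expr2 lerDl.
by apply: sumr_ge0 => j _; rewrite -expr2 sqr_ge0.
Qed.

Lemma enorm_sup_le x a : 0 <= a -> (forall i, `|x i 0| <= a) ->
  enorm x <= n%:R * a.
Proof.
move=> a0 xa; rewrite enorm_le ?mulr_ge0//.
apply: (@le_trans _ _ (n%:R * a ^+ 2)).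
  rewrite mulr_natl -[X in _ *+ X]card_ord -sumr_const; apply: ler_sum => i _.
  by rewrite -expr2 -real_normK ?num_real// ler_sqr// nnegrE.
rewrite exprMn ler_wpM2r ?sqr_ge0// -natrX ler_nat.
by case: n => // m; rewrite -{1}[m.+1]expn1 leq_pexp2l.
Qed.

End enorm.

(** * Finiteness, positivity and scaling of the two integrals *)

Section integrals.
Context (R : realType).
Local Notation mu := (@lebesgue_measure R).

(** The integrand is at most [c^-1] times the sum of the exponential density and its mirror image,
    each of finite mass. *)
Lemma integral_exp_norm1 (c : R) : 0 < c ->
  exists r : R, (\int[mu]_x (expR (- (c * `|x|)))%:E = r%:E)%E.
Proof.
move=> c0.
have mexp : measurable_fun setT (fun x : R => expR (- (c * `|x|))).
  apply: measurableT_comp => //; apply: measurableT_comp => //.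
  by apply: measurable_funM.
have mpdf := measurable_exponential_pdf c.
have pdf0 x : 0 <= exponential_pdf c x by apply: exponential_pdf_ge0; exact: ltW.
have mpdfN : measurable_fun setT
    (fun x : R => exponential_pdf c (affine1 (-1) 0 x)).
  by apply: measurableT_comp mpdf _; exact: measurable_affine1.
suff : (\int[mu]_x (expR (- (c * `|x|)))%:E < +oo)%E.
  move=> fin; exists (fine (\int[mu]_x (expR (- (c * `|x|)))%:E)); rewrite fineK//.
  by rewrite ge0_fin_numE//; apply: integral_ge0 => x _; rewrite lee_fin expR_ge0.
apply: (@le_lt_trans _ _ (c^-1%:E * \int[mu]_x
    ((exponential_pdf c x)%:E + (exponential_pdf c (affine1 (-1) 0 x))%:E))%E).
  rewrite -ge0_integralZl_EFin//; last 3 first.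
  - by move=> x _; rewrite -EFinD lee_fin addr_ge0.
  - by apply/measurable_EFinP/measurable_funD.
  - by rewrite invr_ge0 ltW.
  apply: ge0_le_integral => //.
  - exact/measurable_EFinP.
  - by apply/measurable_EFinP/measurable_funM => //; exact: measurable_funD.
  move=> x _; rewrite -EFinD -EFinM lee_fin ler_pdivlMl//.
  rewrite /affine1 mulN1r addr0.
  have [x0|x0] := leP 0 x.
    by rewrite ger0_norm// (exponential_pdfE _ x0) mulNr lerDl.
  have Nx0 : 0 <= - x by rewrite oppr_ge0 ltW.
  by rewrite ltr0_norm// (exponential_pdfE _ Nx0) mulNr [X in _ <= X]addrC lerDl.
rewrite ge0_integralD//; last 4 first.
- by move=> x _; rewrite lee_fin.
- exact/measurable_EFinP.
- by move=> x _; rewrite lee_fin.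
- exact/measurable_EFinP.
have := @ge0_integral_affine1 R (-1) 0 (fun x => (exponential_pdf c x)%:E).
rewrite normrN1 oppr_eq0 oner_eq0 => /(_ isT) H.
have := H; rewrite mul1e => {H} -> //; last by apply/measurable_EFinP.
by rewrite integral_exponential_pdf// -EFinD -EFinM ltry.
Qed.

Context (n : nat).

Lemma integralRnE (f : 'cV[R]_n -> R) :
  integralRn f = vintegral (fun x => (f x)%:E).
Proof. by []. Qed.

Lemma volumeE (E : set 'cV[R]_n) : measurable (@vec_of_tuple R n @^-1` E) ->
  volume E = vintegral (fun x => (\1_E x)%:E).
Proof.
move=> mE; rewrite /vintegral.
rewrite (eq_integral (fun t => (\1_(@vec_of_tuple R n @^-1` E) t)%:E))//.
by rewrite integral_indic// setIT.
Qed.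

Lemma measurable_eball : measurable (@vec_of_tuple R n @^-1` @eball R n).
Proof.
pose f t := dotv (@vec_of_tuple R n t) (vec_of_tuple t).
have m : measurable_fun setT (f : _ -> measurableTypeR R).
  by apply: measurable_dotv => i; exact: measurable_vec_of_tuple.
rewrite (_ : _ @^-1` _ = f @^-1` `]-oo, 1]).
  by rewrite -[X in measurable X]setTI; apply: m => //; exact: measurable_itv.
by apply/seteqP; split => t; rewrite /= /f /eball/= in_itv/= enorm_le// expr1n.
Qed.

Lemma vmeasurable_eball : vmeasurable (fun x => (\1_(@eball R n) x)%:E).
Proof.
by apply/measurable_EFinP; exact: (measurable_indic (R := R) measurable_eball).
Qed.

Lemma vmeasurable_exp_enorm : vmeasurable (fun x : 'cV[R]_n => (expR (- enorm x))%:E).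
Proof.
by apply: (vmeasurable_enorm (phi := fun r => expR (- r))); apply: measurableT_comp.
Qed.

Lemma le_vintegral (F G : 'cV[R]_n -> \bar R) :
  (forall x, 0 <= F x)%E -> (forall x, F x <= G x)%E ->
  vmeasurable F -> vmeasurable G -> (vintegral F <= vintegral G)%E.
Proof. by move=> F0 FG mF mG; exact: ge0_le_integral. Qed.

(** Each coordinate is at most the norm, so the integrand is dominated by the product of the
    [expR (- n.+1%:R^-1 * |x_i|)]. The weight with [n.+1] also covers dimension zero. *)
Lemma integralRn_exp_enorm_fin :
  exists r : R, integralRn (fun x : 'cV[R]_n => expR (- enorm x)) = r%:E.
Proof.
have n1 : 0 < n.+1%:R^-1 :> R by rewrite invr_gt0.
have [r hr] := integral_exp_norm1 n1.
have mexp : measurable_fun setT (fun x : R => expR (- (n.+1%:R^-1 * `|x|))).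
  apply: measurableT_comp => //; apply: measurableT_comp => //.
  by apply: measurable_funM.
have [mp hp] := vintegral_prod n mexp (fun x => expR_ge0 _) hr.
have e0 (x : 'cV[R]_n) : (0 <= (expR (- enorm x))%:E)%E by rewrite lee_fin expR_ge0.
exists (fine (integralRn (fun x : 'cV[R]_n => expR (- enorm x)))).
rewrite fineK// ge0_fin_numE; last by rewrite integralRnE; exact: vintegral_ge0.
apply: (@le_lt_trans _ _ (r ^+ n)%:E); last exact: ltry.
rewrite -hp integralRnE; apply: le_vintegral => //; last exact: vmeasurable_exp_enorm.
move=> x; rewrite lee_fin -expR_sum ler_expR sumrN lerN2 -mulr_sumr ler_pdivrMl//.
apply: (@le_trans _ _ (\sum_(i < n) enorm x)).
  by apply: ler_sum => i _; exact: normr_coord_le.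
by rewrite sumr_const card_ord -[leLHS]mulr_natl ler_wpM2r ?enorm_ge0// ler_nat.
Qed.

(** The ball contains the cube of the points with all coordinates in [[0, n.+1%:R^-1]]. *)
Lemma volume_eball_gt0 : (0 < volume (@eball R n))%E.
Proof.
have n1 : 0 < n.+1%:R^-1 :> R by rewrite invr_gt0.
pose g : R -> R := \1_`[0, n.+1%:R^-1].
have gr : (\int[mu]_x (g x)%:E = n.+1%:R^-1%:E)%E.
  rewrite integral_indic// setIT.
  rewrite [LHS](lebesgue_measure_itv `[0, n.+1%:R^-1])/= lte_fin n1.
  by rewrite -EFinB subr0.
have mg : measurable_fun setT g by exact: measurable_indic.
have g0 x : 0 <= g x by rewrite /g indicE ler0n.
have [mp hp] := vintegral_prod n mg g0 gr.
rewrite volumeE; last exact: measurable_eball.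
apply: (@lt_le_trans _ _ (n.+1%:R^-1 ^+ n)%:E); first by rewrite lte_fin exprn_gt0.
rewrite -hp; apply: le_vintegral => //.
- by move=> x; rewrite lee_fin prodr_ge0.
- move=> x; rewrite lee_fin.
  have [/forallP xi|] := boolP [forall i, `|x i 0| <= n.+1%:R^-1].
    rewrite [leRHS]indicE mem_set//=.
      by apply: prodr_ile1 => i _; rewrite g0/= /g indicE lern1 leq_b1.
    rewrite /eball/=; apply: le_trans (enorm_sup_le (ltW n1) xi) _.
    by rewrite ler_pdivrMr// mul1r ler_nat.
  rewrite negb_forall => /existsP[i xi].
  rewrite (bigD1 i)//= /g indicE memNset ?mul0r//=.
  rewrite in_itv/= => /andP[x0 x1].
  by move: xi; rewrite ger0_norm// x1.
- exact: vmeasurable_eball.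
Qed.

(** The indicator of the ball is at most [expR 1 * expR (- enorm x)]. *)
Lemma volume_eball_fin : exists r : R, volume (@eball R n) = r%:E.
Proof.
have [C hC] := integralRn_exp_enorm_fin.
exists (fine (volume (@eball R n))); rewrite fineK// ge0_fin_numE; last first.
  by rewrite ltW// volume_eball_gt0.
apply: (@le_lt_trans _ _ (expR 1 * C)%:E); last exact: ltry.
have e0 (x : 'cV[R]_n) : (0 <= (expR (- enorm x))%:E)%E by rewrite lee_fin expR_ge0.
rewrite EFinM -hC integralRnE -vintegralZl ?expR_ge0//; last first.
  exact: vmeasurable_exp_enorm.
rewrite volumeE; last exact: measurable_eball.
apply: le_vintegral.
- by move=> x; rewrite lee_fin indicE ler0n.
- move=> x; rewrite -EFinM lee_fin -expRD indicE.
  have [/set_mem xB|_] := boolP (_ \in _); last by rewrite expR_ge0.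
  by rewrite -[leLHS]expR0 ler_expR subr_ge0.
- exact: vmeasurable_eball.
- have m : measurable_fun setT (fun r : R => expR 1 * expR (- r)).
    by apply: measurable_funM => //; apply: measurableT_comp.
  exact: (vmeasurable_enorm m).
Qed.

Lemma integralRn_exp_enorm_gt0 :
  (0 < integralRn (fun x : 'cV[R]_n => expR (- enorm x)))%E.
Proof.
apply: (@lt_le_trans _ _ ((expR (-1))%:E * volume (@eball R n))%E).
  by rewrite mule_gt0 ?volume_eball_gt0// lte_fin expR_gt0.
rewrite volumeE; last exact: measurable_eball.
rewrite -vintegralZl ?expR_ge0//; last exact: vmeasurable_eball.
rewrite integralRnE; apply: le_vintegral.
- by move=> x; rewrite -EFinM lee_fin mulr_ge0 ?expR_ge0// indicE ler0n.
- move=> x; rewrite -EFinM lee_fin indicE.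
  have [/set_mem xB|_] := boolP (_ \in _); last by rewrite mulr0 expR_ge0.
  by rewrite mulr1 ler_expR lerN2.
- exact: (measurable_funeM _ vmeasurable_eball).
- exact: vmeasurable_exp_enorm.
Qed.

Lemma mem_affine_image (A : affine_map R n) x : affine_invertible A ->
  (A @` @eball R n) x <-> enorm (invmx (linpart A) *m (x - offset A)) <= 1.
Proof.
move=> uA; split=> [[u uB <-]|h].
  by rewrite /affine_app addrK mulKmx.
by exists (invmx (linpart A) *m (x - offset A)); rewrite // /affine_app mulKVmx// subrK.
Qed.

Lemma volume_affine (A : affine_map R n) : affine_invertible A ->
  volume (A @` @eball R n) = (`|\det (linpart A)|%:E * volume (@eball R n))%E.
Proof.
move=> uA; set L := linpart A; set b := offset A.
have preE : A @` @eball R n =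
    (fun x => invmx L *m x + (- (invmx L *m b))) @^-1` @eball R n.
  apply/seteqP; split => x h; last by apply/mem_affine_image; rewrite // mulmxBr.
  by move/mem_affine_image : h => /(_ uA); rewrite mulmxBr.
have mA : measurable (@vec_of_tuple R n @^-1` (A @` @eball R n)).
  rewrite preE -[X in measurable X]setTI.
  pose g t := invmx L *m @vec_of_tuple R n t + - (invmx L *m b).
  have mf : measurable_fun setT (fun t => dotv (g t) (g t) : measurableTypeR R).
    apply: measurable_dotv => i; apply: measurable_mulmx => j;
      exact: measurable_vec_of_tuple.
  rewrite (_ : _ @^-1` _ = (fun t => dotv (g t) (g t)) @^-1` `]-oo, 1]).
    by apply: mf => //; exact: measurable_itv.
  by apply/seteqP; split => t; rewrite /= /eball/= in_itv/= enorm_le// expr1n.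
rewrite volumeE// (volumeE measurable_eball).
have mF : vmeasurable (fun x => (\1_(A @` @eball R n) x)%:E).
  by apply/measurable_EFinP; exact: (measurable_indic (R := R) mA).
rewrite -(vintegral_affine uA b mF); last first.
  by move=> x; rewrite lee_fin indicE ler0n.
congr (_ * _)%E; apply: eq_vintegral => x; congr EFin; rewrite !indicE.
congr ((nat_of_bool _)%:R).
apply/idP/idP => /set_mem h; apply/mem_set; last by exists x.
by have := (mem_affine_image _ uA).1 h; rewrite addrK mulKmx.
Qed.

(** Up to a constant, the Loewner objective is thus [expR t] divided by the absolute value of the
    determinant. *)
Lemma integralRn_exp_norm (A : affine_map R n) (t : R) : affine_invertible A ->
  (`|\det (linpart A)|%:E * integralRn (exp_norm A t) =
   (expR t)%:E * integralRn (fun x : 'cV[R]_n => expR (- enorm x)))%E.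
Proof.
move=> uA.
have m : measurable_fun setT (fun r : R => expR (- r + t)).
  apply: measurableT_comp => //; apply: measurable_funD => //.
have mt := @vmeasurable_enorm R n _ m.
rewrite [LHS](vintegral_affine uA (offset A)
  (F := fun x => (expR (- enorm x + t))%:E))//.
rewrite integralRnE -vintegralZl ?expR_ge0//; last exact: vmeasurable_exp_enorm.
by apply: eq_vintegral => x; rewrite -EFinM -expRD addrC.
Qed.

End integrals.

(** * Determinants and traces *)

Section first_order.
Context (R : realType).

Lemma horner_bound (p : {poly R}) :
  exists B, forall e, 0 <= e <= 1 -> `|p.[e]| <= B.
Proof.
exists (\sum_(i < size p) `|p`_i|) => e /andP[e0 e1].
rewrite horner_coef (le_trans (ler_norm_sum _ _ _))//; apply: ler_sum => i _.
by rewrite normrM ler_piMr// normrX exprn_ile1// ger0_norm.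
Qed.

(** Effective form of letting [e] tend to 0; the later expansions keep their remainders polynomial
    in [e] in order to fit it. *)
Lemma first_order_ge0 (c : R) (p : {poly R}) :
  (forall e, 0 < e -> 0 <= c + e * p.[e]) -> 0 <= c.
Proof.
move=> h; rewrite leNgt; apply/negP => c0.
have [B hB] := horner_bound p.
have B0 : 0 <= B by rewrite (le_trans _ (hB 0 _)) ?normr_ge0// lexx ler01.
(* Chosen so that the perturbation [e * p.[e]] is at most [- c / 2], leaving a negative sum. *)
pose e := Num.min 1 (- c / (2 * (B + 1))).
have e0 : 0 < e by rewrite lt_min ltr01 divr_gt0//; lra.
have e1 : e <= 1 by rewrite ge_min lexx.
have eB : e * (2 * (B + 1)) <= - c.
  by rewrite -ler_pdivlMr ?ge_min ?lexx ?orbT//; lra.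
have := h _ e0; have := hB e; rewrite (ltW e0) e1 => /(_ isT).
rewrite ler_norml => /andP[_ pB].
have : e * p.[e] <= e * B by rewrite ler_pM2l.
nra.
Qed.

Lemma expr_first_order (p : {poly R}) (t : R) n :
  exists q : {poly R},
    (1 + t *: 'X + p * 'X^2) ^+ n = 1 + (n%:R * t) *: 'X + q * 'X^2.
Proof.
elim: n => [|n [q IH]]; first by exists 0; rewrite expr0 mul0r scale0r !addr0 mul0r addr0.
exists ((n%:R * t * t)%:P + p * (1 + (n%:R * t) *: 'X) +
  q * (1 + t *: 'X + p * 'X^2)).
rewrite exprS IH -[in RHS]natr1 -!mul_polyC !(polyCM, polyCD, polyC1); ring.
Qed.

Lemma horner_char_poly n (G : 'M[R]_n) a : (char_poly G).[a] = \det (a%:M - G).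
Proof.
rewrite /char_poly -horner_evalE -det_map_mx; congr (\det _).
apply/matrixP => i j; rewrite !mxE/= horner_evalE.
by rewrite hornerD hornerN hornerMn hornerX hornerC.
Qed.

(** For [e != 0] in positive dimension [n], the determinant is [(- e) ^+ n] times the characteristic
    polynomial of [G] at [- e^-1], so its top two coefficients give the terms of order 0 and 1. *)
Lemma det_first_order n (G : 'M[R]_n) : exists p : {poly R}, forall e,
  \det (1%:M + e *: G) = 1 + e * \tr G + e ^+ 2 * p.[e].
Proof.
case: n G => [|m] G.
  by exists 0 => e; rewrite det_mx00 /mxtrace big_ord0 horner0 !mulr0 !addr0.
exists (\sum_(i < m) (char_poly G)`_i *: (- 'X) ^+ (m.-1 - i)) => e.
have [->|e0] := eqVneq e 0.
  by rewrite scale0r addr0 det1 mul0r expr0n mul0r !addr0.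
have -> : 1%:M + e *: G = (- e) *: ((- e^-1)%:M - G).
  by rewrite scalerBr scale_scalar_mx mulrNN divff// scaleNr opprK.
rewrite detZ -horner_char_poly horner_coef size_char_poly !big_ord_recr/=.
have -> : (char_poly G)`_m.+1 = 1.
  by have /monicP := char_poly_monic G; rewrite lead_coefE size_char_poly.
have := @char_poly_trace _ _ G isT => /= ->.
have k i : (i <= m.+1)%N -> (- e) ^+ m.+1 * (- e^-1) ^+ i = (- e) ^+ (m.+1 - i).
  move=> im; rewrite -[in LHS](subnK im) exprD -mulrA -exprMn mulrNN divff//.
  by rewrite expr1n mulr1.
rewrite mul1r !mulrDr (k m.+1)// subnn expr0 mulrCA k// subSnn expr1.
rewrite (_ : _ * \sum_(i < m) _ =
    e ^+ 2 * (\sum_(i < m) (char_poly G)`_i *: (- 'X) ^+ (m.-1 - i)).[e]).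
  by ring.
rewrite horner_sum !mulr_sumr; apply: eq_bigr => i _.
rewrite mulrCA k; last by rewrite ltnW// ltnS ltnW.
rewrite hornerZ horner_exp hornerN hornerX mulrCA -sqrrN -exprD.
congr (_ * _ ^+ _); case: m i {G k} => [[]//|m] i /=.
have im : (i <= m)%N by rewrite -ltnS.
by rewrite add2n !subSn// leqW.
Qed.

(** Both sides of the hypothesis are 1 at [e = 0]; the conclusion compares their derivatives
    there. *)
Lemma trace_le_of_det_le n (G : 'M[R]_n) (t k : R) :
  (forall e, 0 < e ->
    (\det (1%:M + e *: G)) ^+ 2 <= (1 + e * t + e ^+ 2 * k) ^+ n) ->
  2 * \tr G <= n%:R * t.
Proof.
move=> h; have [p hp] := det_first_order G.
have [q hq] := expr_first_order k%:P t n.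
have [r hr] := expr_first_order p (\tr G) 2.
rewrite -subr_ge0; apply: (@first_order_ge0 _ (q - r)) => e e0.
have := h _ e0; rewrite hp.
have := congr1 (fun f => f.[e]) hq; have := congr1 (fun f => f.[e]) hr.
rewrite !hornerE => Hr Hq.
rewrite /= in Hr Hq.
rewrite (_ : 1 + e * \tr G + _ = 1 + \tr G * e + p.[e] * e * e); last by ring.
rewrite (_ : 1 + e * t + _ = 1 + t * e + k * e * e); last by ring.
rewrite Hr Hq -(pmulr_rge0 _ e0) -subr_ge0 => hh.
by apply: le_trans hh _; rewrite le_eqVlt; apply/orP; left; apply/eqP; ring.
Qed.
End first_order.

(** * Orthogonal triangularization *)

Section triangularization.
Context (R : realType).

Definition orthogonal_mx n (Q : 'M[R]_n) := Q^T *m Q = 1%:M.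

Lemma orthogonal_enorm n (Q : 'M[R]_n) (u : 'cV[R]_n) :
  orthogonal_mx Q -> enorm (Q *m u) = enorm u.
Proof. by move=> hQ; rewrite /enorm dotv_mulmx mulmxA hQ mul1mx. Qed.

Lemma orthogonal_mxM n (P Q : 'M[R]_n) :
  orthogonal_mx P -> orthogonal_mx Q -> orthogonal_mx (P *m Q).
Proof.
by move=> hP hQ; rewrite /orthogonal_mx trmx_mul -mulmxA (mulmxA P^T) hP mul1mx hQ.
Qed.

Lemma orthogonal_mxT n (Q : 'M[R]_n) : orthogonal_mx Q -> orthogonal_mx Q^T.
Proof. by move=> hQ; rewrite /orthogonal_mx trmxK; exact: mulmx1C. Qed.

Lemma orthogonal_det n (Q : 'M[R]_n) : orthogonal_mx Q -> `|\det Q| = 1.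
Proof.
move=> /(congr1 determinant); rewrite det_mulmx det_tr det1 -expr2 => /eqP.
by rewrite sqrf_eq1 => /orP[] /eqP ->; rewrite ?normrN normr1.
Qed.

(** For [a != b], the reflection in the hyperplane orthogonal to [a - b] exchanges the two
    vectors. *)
Lemma householder n (a b : 'cV[R]_n) : enorm a = enorm b ->
  exists2 H : 'M[R]_n, orthogonal_mx H & H *m a = b.
Proof.
move=> ab; have [->|anb] := eqVneq a b.
  by exists 1%:M; rewrite ?mul1mx// /orthogonal_mx trmx1 mul1mx.
pose v := a - b; pose k := dotv v v.
have k0 : k != 0 by rewrite dotv_eq0 subr_eq0.
have vv : v^T *m v = k%:M by rewrite [LHS]mx11_scalar -dotvE.
have ha : dotv v a = k / 2.
  have : dotv a a = dotv b b by rewrite -!sqr_enorm ab.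
  by rewrite /k /v !(dotvDl, dotvDr, dotNv) !(dotvC _ (- b)) !dotNv (dotvC b a) => ?; lra.
have vvv : (v *m v^T) *m (v *m v^T) = k *: (v *m v^T).
  by rewrite mulmxA -(mulmxA v) vv mul_mx_scalar scalemxAl.
exists (1%:M - (2 / k) *: (v *m v^T)).
  set P := (2 / k) *: (v *m v^T).
  have PT : P^T = P by rewrite /P linearZ/= trmx_mul trmxK.
  have PP : P *m P = 2 *: P.
    rewrite /P -scalemxAl -scalemxAr vvv !scalerA; congr (_ *: _).
    by field.
  rewrite /orthogonal_mx [_^T]linearB/= trmx1 PT mulmxBl mul1mx mulmxBr mulmx1 PP.
  by rewrite scaler_nat opprB mulr2n addrK subrK.
rewrite mulmxBl mul1mx -scalemxAl -mulmxA [v^T *m a]mx11_scalar -dotvE ha.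
rewrite mul_mx_scalar scalerA (_ : _ / _ * _ = 1) ?scale1r; last by field.
by rewrite /v opprB addrC subrK.
Qed.

(** Induction on the dimension: a reflection sends the first column to its norm times the first
    basis vector, hence the nonnegative diagonal, and the lower right block is treated next. *)
Lemma qr n (M : 'M[R]_n) : exists2 Q : 'M[R]_n, orthogonal_mx Q &
  (forall i j : 'I_n, (j < i)%N -> (Q *m M) i j = 0) /\ forall i, 0 <= (Q *m M) i i.
Proof.
elim: n M => [|n IH] M.
  by exists 1%:M; [rewrite /orthogonal_mx trmx1 mul1mx|split=> -[]].
pose c : 'cV[R]_(1 + n) := lsubmx (M : 'M[R]_(1 + n)).
pose b : 'cV[R]_(1 + n) := col_mx (enorm c)%:M 0.
have cb : enorm c = enorm b.
  rewrite [RHS]/enorm dotvE /b tr_col_mx mul_row_col mulmx0 addr0 tr_scalar_mx.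
  by rewrite -scalar_mxM mxE eqxx mulr1n -expr2 sqrtr_sqr ger0_norm// enorm_ge0.
have [H hH Hc] := householder cb.
pose N : 'M[R]_(1 + n) := H *m M.
have Nl : lsubmx N = b by rewrite -mulmx_lsub.
have [Q hQ [Q0 Qp]] := IH (drsubmx N).
pose P : 'M[R]_(1 + n) := block_mx 1%:M 0 0 Q.
have PN : P *m N = block_mx (enorm c)%:M (ursubmx N) 0 (Q *m drsubmx N).
  rewrite -[N in LHS]submxK /P mulmx_block !mul1mx !mul0mx !addr0 !add0r.
  have -> : ulsubmx N = usubmx (lsubmx N) by apply/matrixP => i j; rewrite !mxE.
  have -> : dlsubmx N = dsubmx (lsubmx N) by apply/matrixP => i j; rewrite !mxE.
  by rewrite Nl /b col_mxKu col_mxKd mulmx0.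
have hP : orthogonal_mx P.
  rewrite /orthogonal_mx /P tr_block_mx !trmx0 trmx1 mulmx_block.
  rewrite !mul1mx !mul0mx !mulmx0 !addr0 add0r hQ.
  exact/esym/(@scalar_mx_block _ 1 n).
exists (P *m H : 'M[R]_(1 + n)).
  exact: orthogonal_mxM.
rewrite -mulmxA -/N PN; split.
  move=> i j; case: (split_ordP (i : 'I_(1 + n))) => k ->;
    case: (split_ordP (j : 'I_(1 + n))) => l ->.
  - by rewrite !ord1.
  - by rewrite ord1.
  - by move=> _; rewrite [LHS](block_mxEdl (enorm c)%:M) mxE.
  - rewrite /= ltn_add2l => lk; rewrite [LHS](block_mxEdr (enorm c)%:M); exact: Q0.
move=> i; case: (split_ordP (i : 'I_(1 + n))) => k ->.
  by rewrite [X in _ <= X](block_mxEul (enorm c)%:M) ord1 mxE eqxx mulr1n enorm_ge0.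
by rewrite [X in _ <= X](block_mxEdr (enorm c)%:M).
Qed.

Lemma mxtrace_trmx_mul n (A : 'M[R]_n) : \tr (A^T *m A) = \sum_i \sum_j A j i ^+ 2.
Proof.
by apply: eq_bigr => i _; rewrite mxE; apply: eq_bigr => j _; rewrite mxE expr2.
Qed.

(** [c] is the squared Frobenius norm; apply Cauchy-Schwarz to each row. *)
Lemma frobenius_bound n (S : 'M[R]_n) : exists2 c, 0 <= c &
  forall u : 'cV[R]_n, dotv (S *m u) (S *m u) <= c * dotv u u.
Proof.
exists (\sum_i \sum_j S i j ^+ 2).
  by apply: sumr_ge0 => i _; apply: sumr_ge0 => j _; exact: sqr_ge0.
move=> u; rewrite mulr_suml; apply: ler_sum => i _.
have -> : (S *m u) i 0 = dotv (row i S)^T u.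
  by rewrite mxE; apply: eq_bigr => j _; rewrite !mxE.
have -> : \sum_j S i j ^+ 2 = dotv (row i S)^T (row i S)^T.
  by apply: eq_bigr => j _; rewrite !mxE expr2.
set w := (row i S)^T; rewrite -!sqr_enorm -expr2 -exprMn.
rewrite -real_normK ?num_real// ler_sqr ?nnegrE ?mulr_ge0 ?enorm_ge0//.
rewrite ler_norml lerNl -dotNv; apply/andP; split; last exact: cauchy_schwarz.
by rewrite (le_trans (cauchy_schwarz _ _))// -scaleN1r enormZ normrN1 mul1r.
Qed.

End triangularization.

(** * From trace bounds to determinant bounds *)

Section trace_det.
Context (R : realType) (n : nat).
Implicit Types (M : 'M[R]_n) (t : R).

(** Since the supremum of [\tr (C *m M)] over the contractions [C] is the nuclear norm of [M], this
    bounds that norm by [n t]. The factor [r] allows matrices that are contractions only up to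
    second order. *)
Definition trace_bounded M t := forall (C : 'M[R]_n) r, 0 <= r ->
  (forall u, enorm (C^T *m u) <= r * enorm u) -> \tr (C *m M) <= n%:R * (r * t).

Lemma det_upper (T : 'M[R]_n) : (forall i j : 'I_n, (j < i)%N -> T i j = 0) ->
  \det T = \prod_i T i i.
Proof.
move=> T0; rewrite -det_tr det_trig.
  by apply: eq_bigr => i _; rewrite mxE.
by apply/is_trig_mxP => i j ij; rewrite mxE T0.
Qed.

(** Take for [C] the orthogonal factor that makes [T = Q M] triangular: the trace bounds the sum of
    the diagonal, and the arithmetic-geometric mean inequality its product. Equality makes the
    diagonal constant, and a second choice of [C] makes [T] symmetric. *)
Lemma trace_bounded_det M t : trace_bounded M t ->
  `|\det M| <= t ^+ n /\
  (M \in unitmx -> `|\det M| = t ^+ n -> M^T *m M = (t ^+ 2)%:M).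
Proof.
move=> h; have [Q hQ] := qr M.
have [T TQ] : exists T, T = Q *m M by exists (Q *m M).
rewrite -TQ => -[T0 Tp].
have trT : \tr T <= n%:R * t.
  have := h Q 1 ler01; rewrite mul1r -TQ; apply => u.
  by rewrite mul1r orthogonal_enorm//; exact: orthogonal_mxT.
have detT : `|\det M| = \prod_i T i i.
  rewrite -det_upper// -[RHS]ger0_norm; last by rewrite det_upper// prodr_ge0.
  by rewrite TQ det_mulmx normrM (orthogonal_det hQ) mul1r.
have MM : M^T *m M = T^T *m T.
  by rewrite TQ trmx_mul -mulmxA (mulmxA Q^T) hQ mul1mx.
have detE : `|\det M| <= (\tr T / n%:R) ^+ n
    ?= iff [forall i, forall j, T i i == T j j].
  have := @leif_AGM R 'I_n predT (fun i => T i i) (fun i _ => Tp i).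
  by rewrite -detT card_ord.
have trn : (\tr T / n%:R) ^+ n <= t ^+ n.
  case: (posnP n) => [n0|n0]; first by move: (\tr T / n%:R) => a; rewrite n0 !expr0.
  rewrite lerXn2r// ?nnegrE.
  - by rewrite divr_ge0// sumr_ge0.
  - rewrite -(pmulr_rge0 _ (_ : 0 < n%:R)) ?ltr0n// (le_trans _ trT)//.
    by rewrite sumr_ge0.
  - by rewrite ler_pdivrMr ?ltr0n// mulrC.
split; first exact: le_trans detE.1 trn.
move=> uM dM.
case: (posnP n) => [n0|n0]; first exact: eq_mx_dim0.
have e1 : `|\det M| = (\tr T / n%:R) ^+ n.
  by apply/le_anti; rewrite detE.1 dM trn.
have Tii i j : T i i = T j j.
  have /forallP/(_ i)/forallP/(_ j)/eqP// : [forall i, forall j, T i i == T j j].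
  by rewrite -detE.2 -e1.
have n0R : 0 < n%:R :> R by rewrite ltr0n.
have t0 : 0 <= t.
  by rewrite -(pmulr_rge0 _ n0R) (le_trans _ trT)// sumr_ge0.
have trE : \tr T / n%:R = t.
  by apply/eqP; rewrite -(eqrXn2 n0)// ?divr_ge0 ?sumr_ge0// -e1 dM.
have tr_t : \tr T = n%:R * t by rewrite -trE mulrC divfK// gt_eqF.
have Tt i : T i i = t.
  apply: (mulfI (lt0r_neq0 n0R)); rewrite -tr_t mulr_natl /mxtrace.
  by rewrite (eq_bigr (fun=> T i i)) ?sumr_const ?card_ord.
(* The skew-symmetric perturbation [1 + e S] is a contraction up to [O(e ^ 2)],
   so the trace is stationary along it, which forces [S = 0]. *)
pose S := T^T - T.
have [c c0 Sc] := frobenius_bound S.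
have ST : S^T = - S by rewrite /S linearB/= trmxK opprB.
have dotS (u : 'cV_n) : dotv u (S *m u) = 0.
  have : dotv u (S *m u) = - dotv u (S *m u).
    by rewrite {1}dotvC !dotvE trmx_mul ST mulmxN mulNmx mulmxA mxE.
  by move=> ?; lra.
(* As [S] is skew, [\tr (S *m T^T) = - \tr (S *m T)]; hence the squared Frobenius norm of
   [S = T^T - T] is twice [\tr (S *m T)]. *)
have trS : \tr (S *m T) = 2^-1 * \sum_i \sum_j S j i ^+ 2.
  rewrite -mxtrace_trmx_mul ST mulNmx.
  have e : \tr (S *m T^T) = - \tr (S *m T).
    by rewrite -mxtrace_tr trmx_mul trmxK ST mulmxN raddfN/= mxtrace_mulC.
  have -> : S *m S = S *m T^T - S *m T by rewrite -mulmxBr.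
  by rewrite opprB raddfB/= e; field.
have : 0 <= - \tr (S *m T).
  apply: (@first_order_ge0 _ _ (c * n%:R * t)%:P) => e e0.
  (* Since [dotv u (S *m u) = 0], the squared norm of [u - e S u] is at most [1 + e ^+ 2 * c] times
     that of [u], so the linear term in [e] is absent from the factor [r]. *)
  have := h ((1%:M + e *: S) *m Q) (1 + e ^+ 2 * c).
  have r0 : 0 <= 1 + e ^+ 2 * c by rewrite addr_ge0// mulr_ge0// sqr_ge0.
  move=> /(_ r0).
  have hu (u : 'cV_n) : enorm (((1%:M + e *: S) *m Q)^T *m u) <=
      (1 + e ^+ 2 * c) * enorm u.
    rewrite trmx_mul -mulmxA orthogonal_enorm; last exact: orthogonal_mxT.
    rewrite enorm_le ?mulr_ge0 ?enorm_ge0//.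
    rewrite [_^T]linearD/= trmx1 linearZ/= ST mulmxDl mul1mx scalerN mulNmx.
    rewrite -scalemxAl.
    rewrite !(dotvDl, dotvDr, dotNv, dotvN, dotvZl, dotvZr) (dotvC _ u) !dotS.
    rewrite exprMn sqr_enorm.
    have h1 := ler_wpM2l (sqr_ge0 e) (Sc u).
    have h2 : 0 <= e ^+ 2 * c * dotv u u.
      by apply: mulr_ge0 (dotv_ge0 _); rewrite mulr_ge0 ?sqr_ge0.
    have h3 : 0 <= (e ^+ 2 * c) ^+ 2 * dotv u u.
      by rewrite mulr_ge0 ?sqr_ge0 ?dotv_ge0.
    move: h1 h2 h3; set a := dotv u u; set b := dotv _ _; lra.
  move=> /(_ hu); rewrite hornerC.
  rewrite -mulmxA -TQ mulmxDl mul1mx -scalemxAl mxtraceD mxtraceZ tr_t.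
  rewrite mulrDl mul1r mulrDr lerD2l => ht.
  rewrite -(pmulr_rge0 _ e0) mulrDr mulrN addrC subr_ge0.
  by apply: le_trans ht _; rewrite le_eqVlt; apply/orP; left; apply/eqP; ring.
rewrite oppr_ge0 trS pmulr_rle0 ?invr_gt0// => S0.
have Sij i j : S i j = 0.
  have s0 k l : 0 <= S k l ^+ 2 by exact: sqr_ge0.
  have /eqP : \sum_i \sum_j S j i ^+ 2 = 0.
    by apply/le_anti; rewrite S0 sumr_ge0// => k _; rewrite sumr_ge0.
  rewrite psumr_eq0 => [/allP/(_ j (mem_index_enum _))/= /eqP/eqP|k _];
    last exact: sumr_ge0.
  rewrite psumr_eq0 => [/allP/(_ i (mem_index_enum _))/=|k _]; last exact: s0.
  by rewrite sqrf_eq0 => /eqP.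
(* Symmetric and upper triangular, [T] is diagonal. *)
have TE : T = t%:M.
  apply/matrixP => i j; rewrite mxE.
  have Tsym : T i j = T j i.
    by apply/eqP; rewrite -subr_eq0; have := Sij j i; rewrite !mxE => ->.
  have [ij|ij|ij] := ltngtP i j.
  - by rewrite Tsym T0// -val_eqE/= ltn_eqF.
  - by rewrite T0// -val_eqE/= gtn_eqF.
  - by move/val_inj : ij => ->; rewrite eqxx mulr1n.
by rewrite MM TE tr_scalar_mx -scalar_mxM expr2.
Qed.
End trace_det.

(** * Minimal ellipsoids centered at the origin *)

Section centered_ellipsoid.
Context (R : realType) (n : nat) (K : set 'cV[R]_n) (L : 'M[R]_n).
Hypothesis uL : L \in unitmx.
Hypothesis KL : forall u, K (L *m u) -> enorm u <= 1.
Hypothesis Lmin : forall A : affine_map R n, affine_invertible A ->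
  K `<=` A @` @eball R n -> `|\det L| <= `|\det (linpart A)|.

Lemma detL_gt0 : 0 < `|\det L|.
Proof. by rewrite normr_gt0 -unitfE -unitmxE. Qed.

(* Perturbing by [1 + e G / 2] rather than by a square root of [1 + e G] only
   costs a term in [e ^ 2] and requires neither symmetry nor positivity. *)
Lemma minimal_ellipsoid_trace (G : 'M[R]_n) (b : 'cV[R]_n) (t : R) :
  (forall u, K (L *m u) -> dotv u (G *m u) + dotv b u <= t) ->
  \tr G <= n%:R * t.
Proof.
move=> hG; have [c c0 Gc] := frobenius_bound G.
(* The first summand bounds a quarter of the squared norm of [G u + b], which is at most
   [2 (c + |b|^2)]; the summand [t ^+ 2] keeps [r2] positive for every [e]. *)
pose k := (c + dotv b b) / 2 + t ^+ 2.
suff : 2 * \tr (2^-1 *: G) <= n%:R * t by rewrite mxtraceZ mulrA divff// mul1r.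
apply: (@trace_le_of_det_le _ _ _ _ k) => e e0; rewrite scalerA.
set S := 1%:M + _; pose r2 := 1 + e * t + e ^+ 2 * k; rewrite -/r2.
have kt : t ^+ 2 <= k.
  by rewrite lerDr divr_ge0// addr_ge0// dotv_ge0.
have r20 : 0 < r2.
  apply: (@lt_le_trans _ _ (1 + e * t + (e * t) ^+ 2)); first nra.
  by rewrite lerD2l exprMn ler_wpM2l ?sqr_ge0.
have [S0|S0] := eqVneq (\det S) 0; first by rewrite S0 expr0n/= exprn_ge0// ltW.
have uS : S \in unitmx by rewrite unitmxE unitfE.
pose r := Num.sqrt r2.
have r0 : 0 < r by rewrite sqrtr_gt0.
have rr : r ^+ 2 = r2 by rewrite sqr_sqrtr// ltW.
pose N := L *m invmx S.
have dN : \det N = \det L / \det S by rewrite det_mulmx det_inv.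
(* The inverse of this map sends [L u] to [(S u + (e / 2) b) / r], so the ellipsoid consists of the
   [L u] with [|S u + (e / 2) b| <= r]. *)
pose A := AffineMap (r *: N) (N *m (- (e / 2) *: b)).
have uA : affine_invertible A.
  rewrite /affine_invertible unitmxE/= detZ dN unitfE.
  rewrite !mulf_neq0 ?expf_neq0 ?invr_eq0 ?(gt_eqF r0)//.
  by rewrite -normr_gt0 detL_gt0.
have KA : K `<=` A @` @eball R n.
  move=> x Kx; pose u := invmx L *m x.
  have Ku : K (L *m u) by rewrite /u mulKVmx.
  exists (r^-1 *: (S *m u + (e / 2) *: b)).
    rewrite /eball/= enormZ ger0_norm ?invr_ge0 ?(ltW r0)//.
    rewrite mulrC ler_pdivrMr// mul1r enorm_le ?(ltW r0)// rr.
    have -> : S *m u + (e / 2) *: b = u + (e / 2) *: (G *m u + b).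
      by rewrite /S mulmxDl mul1mx -scalemxAl scalerDr addrA mulrC.
    set w := G *m u + b.
    have w2 : dotv w w <= 2 * (c + dotv b b).
      have h1 := dotv_ge0 (G *m u - b); have h2 := Gc u.
      have : c * dotv u u <= c.
        by rewrite ler_piMr// -sqr_enorm expr_le1 ?enorm_ge0// KL.
      move: h1 h2; rewrite /w !(dotvDl, dotvDr, dotNv, dotvN) (dotvC b); lra.
    have uu : dotv u u <= 1 by rewrite -sqr_enorm expr_le1 ?enorm_ge0// KL.
    have uw : dotv u w <= t by rewrite /w dotvDr (dotvC u b); exact: hG.
    clearbody w; rewrite !(dotvDl, dotvDr, dotvZl, dotvZr) (dotvC w u).
    have h3 : e * dotv u w <= e * t by rewrite ler_pM2l.
    have h4 : e ^+ 2 * dotv w w <= e ^+ 2 * (2 * (c + dotv b b)).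
      by rewrite ler_wpM2l ?sqr_ge0.
    have h5 : 0 <= e ^+ 2 * t ^+ 2 by rewrite mulr_ge0 ?sqr_ge0.
    rewrite /r2 /k; lra.
  rewrite /affine_app/= -scalemxAl -scalemxAr scalerA divff ?gt_eqF// scale1r.
  by rewrite -mulmxDr scaleNr addrK /N -mulmxA mulKmx// /u mulKVmx.
(* Minimality of [L] now says that the absolute value of [\det S] is at most [r ^+ n]. *)
have := Lmin uA KA; rewrite /= detZ dN normrM normrM normrV ?unitfE// normrX.
rewrite (gtr0_norm r0) mulrCA -[leLHS]mulr1 ler_pM2l ?detL_gt0//.
rewrite ler_pdivlMr ?normr_gt0// mul1r => dS.
rewrite -rr -exprM mulnC exprM -[leLHS]real_normK ?num_real//.
by rewrite ler_sqr ?nnegrE// exprn_ge0// ltW.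
Qed.

(* On [L^-1 K] the hypothesis gives
   [<b, u>^2 + |b| <b, u> + 2 t |b| |u|^2 <= 2 t |b|]. *)
Lemma minimal_ellipsoid_center (b : 'cV[R]_n) (t : R) : 0 <= t ->
  (forall u, K (L *m u) -> t * enorm u + dotv b u <= t) -> b = 0.
Proof.
move=> t0 hb; pose a := enorm b.
have a0 : 0 <= a by exact: enorm_ge0.
(* The trace of this matrix is [a ^+ 2 + 2 n t a], while the bound is [n (2 t a)], which leaves
   [a ^+ 2 <= 0]. *)
have := @minimal_ellipsoid_trace (b *m b^T + (2 * t * a)%:M) (a *: b) (2 * t * a).
rewrite mxtraceD mxtrace_mulC mxtrace_scalar.
rewrite [\tr _](_ : _ = a ^+ 2); last first.
  by rewrite sqr_enorm dotvE trace_mx11.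
move=> h; suff : a ^+ 2 <= 0.
  by rewrite sqr_enorm => b0; apply/eqP; rewrite -dotv_eq0 eq_le b0 dotv_ge0.
rewrite -(lerD2r (2 * t * a *+ n)) add0r -[leRHS]mulr_natl; apply: h => u Ku.
have u1 : enorm u <= 1 by exact: KL.
have u0 := enorm_ge0 u.
have hu : t * enorm u + dotv b u <= t by exact: hb.
rewrite mulmxDl dotvDr mul_scalar_mx dotvZr dotvZl -mulmxA.
have -> : dotv u (b *m (b^T *m u)) = dotv b u ^+ 2.
  by rewrite [b^T *m u]mx11_scalar mul_mx_scalar dotvZr -dotvE expr2 (dotvC u).
have bu : - a <= dotv b u.
  rewrite lerNl -dotNv (le_trans (cauchy_schwarz _ _))// -scaleN1r enormZ normrN1 mul1r.
  by rewrite ler_piMr.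
have bu' : dotv b u <= a.
  by rewrite (le_trans (cauchy_schwarz _ _))// ler_piMr.
rewrite -sqr_enorm.
move: u0 u1 hu bu bu'; move: (enorm u) (dotv b u) => p q p0 p1 hu aq qa.
have ta : 0 <= t * a by rewrite mulr_ge0.
have p2 : 0 <= t * a * (1 - p) * p by rewrite !mulr_ge0// subr_ge0.
(* If [q <= 0], then [q (q + a) <= 0]; otherwise [q + a <= 2 a] and [q <= t (1 - p)]. *)
have [q0|q0] := leP q 0.
  have : q * (q + a) <= 0 by rewrite mulr_le0_ge0//; lra.
  have : 0 <= t * a * (1 - p) by rewrite mulr_ge0// subr_ge0.
  lra.
have h1 : q * (q + a) <= q * (2 * a) by rewrite ler_pM2l//; lra.
have h2 : q * (2 * a) <= t * (1 - p) * (2 * a) by rewrite ler_wpM2r//; lra.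
lra.
Qed.

(** By Cauchy-Schwarz [<C^T u, M u + b> <= r t]; the linear term of the first-order condition is
    [C b]. *)
Lemma lowner_trace_bounded (M : 'M[R]_n) (b : 'cV[R]_n) t : 0 <= t ->
  (forall u, K (L *m u) -> enorm (M *m u + b) <= t) -> trace_bounded M t.
Proof.
move=> t0 h C r r0 hC; apply: (minimal_ellipsoid_trace (b := C *m b)) => u Ku.
rewrite -mulmxA (dotvC (C *m b)) -dotvDr -mulmxDr dotv_mulmx.
apply: le_trans (cauchy_schwarz _ _) _.
apply: ler_pM; rewrite ?enorm_ge0//; last exact: h.
by apply: le_trans (hC u) _; rewrite ler_piMr// KL.
Qed.

(** Here Cauchy-Schwarz only concerns [<C^T u, M u>], and the linear term is rescaled to [r b]. *)
Lemma john_trace_bounded (M : 'M[R]_n) (b : 'cV[R]_n) t :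
  (forall u, K (L *m u) -> enorm (M *m u) + dotv b u <= t) ->
  trace_bounded M t.
Proof.
move=> h C r r0 hC; apply: (minimal_ellipsoid_trace (b := r *: b)) => u Ku.
rewrite -mulmxA dotv_mulmx dotvZl.
apply: le_trans (ler_wpM2l r0 (h u Ku)); rewrite mulrDr lerD2r.
apply: le_trans (cauchy_schwarz _ _) _; rewrite ler_wpM2r ?enorm_ge0//.
by apply: le_trans (hC u) _; rewrite ler_piMr// KL.
Qed.

End centered_ellipsoid.

(** * Isotropic matrices and the power-exponential inequality *)

Section equality_case.
Context (R : realType) (n : nat).

Lemma enorm_isotropic (M : 'M[R]_n) (t : R) u : 0 <= t ->
  M^T *m M = (t ^+ 2)%:M -> enorm (M *m u) = t * enorm u.
Proof.
move=> t0 MM; rewrite /enorm dotv_mulmx mulmxA MM mul_scalar_mx dotvZl.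
by rewrite sqrtrM ?sqr_ge0// sqrtr_sqr ger0_norm.
Qed.

(** The [n]-th power of [1 + x <= expR x] at [x = t / n - 1], strict unless [x = 0]. In dimension
    zero it reads [1 <= expR t]. *)
Lemma expr_le_expR (t : R) : 0 <= t ->
  t ^+ n <= expR (t - n%:R) * n%:R ^+ n ?= iff (t == n%:R).
Proof.
move=> t0; apply/leifP; case: eqP => [->|/eqP tn].
  by rewrite subrr expR0 mul1r.
case: (posnP n) tn => [n0|n0].
  rewrite n0 !expr0 subr0 mulr1 => tn.
  by rewrite -expR0 ltr_expR lt_neqAle eq_sym tn.
have n0R : 0 < n%:R :> R by rewrite ltr0n.
move=> tn.
have tn0 : t / n%:R - 1 != 0.
  rewrite subr_eq0; apply: contra tn => /eqP h.
  by rewrite -[t](divfK (lt0r_neq0 n0R)) h mul1r.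
have := expR_gt1Dx tn0; rewrite addrC subrK => h.
have -> : t - n%:R = n%:R * (t / n%:R - 1) by field; rewrite gt_eqF.
rewrite expRM_natl -exprMn ltrXn2r//?nnegrE// -?lt0n// ?mulr_ge0 ?expR_ge0//.
by rewrite -ltr_pdivrMr.
Qed.

End equality_case.

(** * Loewner and John functions *)

Section functionals_of_indicator.
Context (R : realType) (n : nat).
Implicit Types (K : set 'cV[R]_n) (A : affine_map R n).

Lemma potential_indic K x : potential \1_K x = if x \in K then 0%E else +oo%E.
Proof.
rewrite /potential indicE; case: ifP => _; last by rewrite le0_lneNy.
by rewrite [lne _]lne1 oppe0.
Qed.

Lemma lowner_feasible_indic K A t : lowner_feasible \1_K A t <->
  affine_invertible A /\ forall x, K x -> enorm (A x) <= t.
Proof.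
split=> -[uA h]; split=> // x.
  move=> Kx; have := h x; rewrite potential_indic mem_set//.
  by rewrite lee_fin subr_le0.
rewrite potential_indic; case: ifPn => [/set_mem Kx|_]; last by rewrite leey.
by rewrite lee_fin subr_le0; exact: h.
Qed.

(** Describes the infimum by its lower bounds; [K] is nonempty because [inf] of the empty set is
    0. *)
Lemma polar_indic_ge K (s : R) y : K !=set0 ->
  (s <= polar \1_K y) <-> forall x, K x -> s <= expR (- dotv x y).
Proof.
move=> [x0 Kx0]; rewrite /polar; set E := [set _ | _ in _].
have EE : E = [set expR (- dotv x y) | x in K].
  apply/seteqP; split=> _ [x /= Kx <-].
    move: Kx; rewrite indicE; have [/set_mem Kx|_] := boolP (x \in K); last first.
      by rewrite ltxx.
    by move=> _; exists x => //; rewrite divr1.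
  by exists x; rewrite /= indicE mem_set//= divr1.
rewrite EE; split=> [h x Kx|h].
  apply: le_trans h _; apply: ge_inf; last by exists x.
  by exists 0 => _ [z _ <-]; rewrite expR_ge0.
apply: lb_le_inf; first by exists (expR (- dotv x0 y)), x0.
by move=> _ [x Kx <-]; exact: h.
Qed.

(** With [x = L u] the exponent is [- <u, L^T y> + c |u| - t]: by Cauchy-Schwarz it is least at
    [u = 0] if [|L^T y| <= c], and otherwise it is unbounded below. *)
Lemma polar_exp_norm (L : 'M[R]_n) (c t : R) y : L \in unitmx -> 0 <= c ->
  polar (exp_norm (AffineMap (c *: invmx L) 0) t) y =
  (if enorm (L^T *m y) <= c then expR (- t) else 0).
Proof.
move=> uL c0; rewrite /polar; set E := [set _ | _ in _].
have EE u : E (expR (- dotv u (L^T *m y) + c * enorm u - t)).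
  exists (L *m u); first by rewrite /exp_norm/= expR_gt0.
  rewrite /exp_norm /affine_app/= addr0 -scalemxAl mulKmx// enormZ ger0_norm//.
  by rewrite -expRN -expRD dotv_mulmx trmxK; congr expR; ring.
have EI v : E v -> exists u, v = expR (- dotv u (L^T *m y) + c * enorm u - t).
  move=> [x _ <-]; exists (invmx L *m x).
  rewrite /exp_norm /affine_app/= addr0 -scalemxAl enormZ ger0_norm//.
  rewrite -expRN -expRD dotv_mulmx trmxK mulKVmx//; congr expR; ring.
have E0 : has_lbound E by exists 0 => v /EI [u ->]; rewrite expR_ge0.
set z := L^T *m y in EE EI *; case: ifPn => [zc|]; last rewrite -ltNge => zc.
  apply/le_anti/andP; split.
    by apply: ge_inf => //; have := EE 0; rewrite dot0v enorm0 mulr0 oppr0 !add0r.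
  apply: lb_le_inf; first by exists (expR (- dotv 0 z + c * enorm (0 : 'cV[R]_n) - t)).
  move=> v /EI [u ->]; rewrite ler_expR lerDr addrC subr_ge0.
  apply: le_trans (cauchy_schwarz _ _) _.
  by rewrite mulrC ler_wpM2r ?enorm_ge0.
apply/le_anti/andP; split; last first.
  apply: lb_le_inf; first by exists (expR (- dotv 0 z + c * enorm (0 : 'cV[R]_n) - t)).
  by move=> v /EI [u ->]; rewrite expR_ge0.
apply/ler_addgt0Pl => e e0; rewrite addr0.
(* along u = k z the exponent is - k |z| (|z| - c) - t *)
have z0 : 0 < enorm z * (enorm z - c).
  by rewrite mulr_gt0 ?subr_gt0//; exact: le_lt_trans c0 zc.
pose k := Num.max 0 ((- t - ln e) / (enorm z * (enorm z - c))).
have k0 : 0 <= k by rewrite le_max lexx.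
apply: (@le_trans _ _ (expR (- dotv (k *: z) z + c * enorm (k *: z) - t))).
  exact: ge_inf.
rewrite -[leRHS]lnK ?posrE// ler_expR.
have : (- t - ln e) / (enorm z * (enorm z - c)) <= k by rewrite le_max lexx orbT.
rewrite ler_pdivrMr// dotvZl -sqr_enorm enormZ ger0_norm//; lra.
Qed.

Lemma eq_scaled_indic (s : R) (A B : affine_map R n) :
  A @` @eball R n = B @` @eball R n ->
  scaled_indic s A = scaled_indic s B.
Proof. by move=> AB; apply/funext => x; rewrite /scaled_indic AB. Qed.

Lemma polar_indic_ge0 K y : K !=set0 -> 0 <= polar \1_K y.
Proof. by move=> K0; apply/polar_indic_ge => // x _; exact: expR_ge0. Qed.

(** The left side of the inequality is the maximum of [<x, A v>] over the ball, the support function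
    of the ellipsoid at [x]. *)
Lemma john_feasible_polar_indic K (s : R) A : K !=set0 ->
  john_feasible (polar \1_K) s A <->
  [/\ 0 < s, affine_invertible A &
    forall x, K x -> enorm ((linpart A)^T *m x) + dotv (offset A) x <= - ln s].
Proof.
move=> K0; split=> [[s0 _ uA h]|[s0 uA h]].
  split=> // x Kx; set w := (linpart A)^T *m x.
  (* The point of the ball where [<w, v>] is maximal; if [w = 0], the inverse of 0 is 0 and
     [v = 0]. *)
  pose v := (enorm w)^-1 *: w.
  have wv : dotv w v = enorm w.
    rewrite dotvZr -sqr_enorm expr2.
    have [->|w0] := eqVneq (enorm w) 0; first by rewrite !mulr0.
    by rewrite mulKf.
  have vB : eball v.
    rewrite /eball/= enormZ ger0_norm ?invr_ge0 ?enorm_ge0//.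
    by have [->|w0] := eqVneq (enorm w) 0; [rewrite mulr0|rewrite mulVf].
  have := h (A v); rewrite /scaled_indic indicE mem_set ?mulr1; last by exists v.
  move=> /(polar_indic_ge _ _ K0)/(_ x Kx).
  rewrite -[X in X <= _]lnK ?posrE// ler_expR lerNr /affine_app dotvDr dotv_mulmx wv.
  by rewrite (dotvC x).
have key v : eball v -> s <= polar \1_K (A v).
  move=> vB; apply/polar_indic_ge => // x Kx.
  rewrite -[X in X <= _]lnK ?posrE// ler_expR lerNr /affine_app dotvDr dotv_mulmx.
  rewrite (dotvC x); apply: le_trans (h x Kx); rewrite lerD2r.
  by rewrite (le_trans (cauchy_schwarz _ _))// ler_piMr ?enorm_ge0.
split=> //.
  (* The bound by the supremum norm follows from the value at the center of the ellipsoid. *)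
  have B0 : eball (0 : 'cV[R]_n) by rewrite /eball/= enorm0.
  apply: (@le_trans _ _ `|polar \1_K (A 0)|%:E).
    by rewrite lee_fin (le_trans (key _ B0))// ler_norm.
  by apply: ereal_sup_ubound; exists (A 0).
move=> x; rewrite /scaled_indic indicE.
have [/set_mem[v vB <-]|_] := boolP (x \in _); first by rewrite mulr1; exact: key.
by rewrite mulr0 polar_indic_ge0.
Qed.

End functionals_of_indicator.

(** * Explicit Loewner and John functions *)

Section optimizers.
Context (R : realType) (n : nat) (K : set 'cV[R]_n) (L : 'M[R]_n).
Hypothesis uL : L \in unitmx.
Hypothesis K0 : K !=set0.
Hypothesis KL : forall u, K (L *m u) -> enorm u <= 1.
Hypothesis Lmin : forall A : affine_map R n, affine_invertible A ->
  K `<=` A @` @eball R n -> `|\det L| <= `|\det (linpart A)|.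

Let nn0 : 0 < (n%:R : R) ^+ n.
Proof. by case: (posnP n) => [->|n0]; rewrite ?expr0// exprn_gt0// ltr0n. Qed.

Let scaled_inv_unit : n%:R *: invmx L \in unitmx.
Proof.
rewrite unitmxE detZ unitfE mulf_neq0 ?(gt_eqF nn0)//.
by rewrite -unitfE -unitmxE unitmx_inv.
Qed.

Lemma isotropic_scale (M : 'M[R]_n) : M^T *m M = (n%:R ^+ 2)%:M ->
  exists2 Q, orthogonal_mx Q & M^T = n%:R *: Q.
Proof.
move=> MM; case: (posnP n) => [n0|n0].
  by exists 1%:M; [rewrite /orthogonal_mx trmx1 mul1mx|exact: eq_mx_dim0].
have n0R : n%:R != 0 :> R by rewrite pnatr_eq0 -lt0n.
exists (n%:R^-1 *: M^T); last by rewrite scalerA divff// scale1r.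
rewrite /orthogonal_mx; apply: mulmx1C.
rewrite linearZ/= trmxK -scalemxAl -scalemxAr MM scalerA.
by rewrite scale_scalar_mx; congr (_%:M); field.
Qed.

(** A feasible [(A, t)] satisfies [|det (A L)| <= t^n <= e^(t - n) n^n], which is the comparison of
    its integral with the candidate's. Equality makes [A L] equal to [n] times an isometry, and the
    first-order condition then removes the offset. *)
Lemma lowner_fun_indic :
  lowner_fun \1_K = exp_norm (AffineMap (n%:R *: invmx L) 0) n%:R.
Proof.
set A0 := AffineMap _ _.
have uA0 : affine_invertible A0 by exact: scaled_inv_unit.
have [C hC] := integralRn_exp_enorm_fin R n.
have C0 : 0 < C by rewrite -lte_fin -hC integralRn_exp_enorm_gt0.
have dL := detL_gt0 uL.
have dA (A : affine_map R n) : affine_invertible A -> 0 < `|\det (linpart A)|.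
  by move=> uA; rewrite normr_gt0 -unitfE -unitmxE.
have IE (A : affine_map R n) t : affine_invertible A ->
    integralRn (exp_norm A t) = (expR t * C / `|\det (linpart A)|)%:E.
  move=> uA; have := integralRn_exp_norm t uA; rewrite hC -EFinM => h.
  have d0 := dA _ uA; rewrite mulrC EFinM -h muleA -EFinM mulVf ?gt_eqF//.
  by rewrite mul1e.
have d0E : `|\det (linpart A0)| = n%:R ^+ n / `|\det L|.
  by rewrite /= detZ det_inv normrM normrV ?unitfE -?normr_gt0// ger0_norm// ltW.
have feas (A : affine_map R n) t : lowner_feasible \1_K A t ->
    [/\ affine_invertible A, 0 <= t,
      forall u, K (L *m u) -> enorm (linpart A *m L *m u + offset A) <= t &
      trace_bounded (linpart A *m L) t].
  move=> /lowner_feasible_indic[uA h].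
  have t0 : 0 <= t.
    by have [x0 Kx0] := K0; exact: le_trans (enorm_ge0 _) (h _ Kx0).
  have h' u : K (L *m u) -> enorm (linpart A *m L *m u + offset A) <= t.
    by move=> Ku; rewrite -mulmxA; exact: h.
  by split => //; exact: lowner_trace_bounded h'.
have le_int (A : affine_map R n) t : lowner_feasible \1_K A t ->
    (integralRn (exp_norm A0 n%:R) <= integralRn (exp_norm A t))%E /\
    ((integralRn (exp_norm A t) <= integralRn (exp_norm A0 n%:R))%E ->
      t = n%:R /\ `|\det (linpart A *m L)| = n%:R ^+ n).
  move=> /feas [uA t0 _ tb]; have [dt _] := trace_bounded_det tb.
  have ht := @expr_le_expR R n t t0.
  have dAL : `|\det (linpart A *m L)| = `|\det (linpart A)| * `|\det L|.
    by rewrite det_mulmx normrM.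
  have a0 := dA _ uA; have e0 := expR_gt0 (n%:R : R).
  (* With this common factor the two integrals become the two ends of the chain of inequalities. *)
  pose c := expR n%:R * C / (n%:R ^+ n * `|\det (linpart A)|).
  have c0 : 0 < c by rewrite divr_gt0// mulr_gt0.
  have -> : integralRn (exp_norm A0 n%:R) = (`|\det (linpart A *m L)| * c)%:E.
    rewrite IE// d0E dAL /c; congr EFin.
    move: (n%:R ^+ n) nn0 (expR _) => N N0 k; field.
    by rewrite ?gt_eqF.
  have -> : integralRn (exp_norm A t) = (expR (t - n%:R) * n%:R ^+ n * c)%:E.
    have ee : expR t = expR (t - n%:R) * expR n%:R by rewrite -expRD subrK.
    rewrite IE// ee /c; congr EFin.
    move: (n%:R ^+ n) nn0 => N N0; field.
    by rewrite ?gt_eqF.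
  rewrite !lee_fin !ler_pM2r//; split; first exact: le_trans dt ht.
  move=> kd; have /eqP := le_anti (introT andP (conj (ht.1) (le_trans kd dt))).
  rewrite ht.2 => /eqP tn; split=> //.
  apply: le_anti; rewrite -{1}tn dt/=.
  by move: kd; rewrite tn subrr expR0 mul1r.
apply: xget_unique.
  exists A0, n%:R; split=> //; split.
    apply/lowner_feasible_indic; split=> // x Kx.
    rewrite /affine_app/= addr0 -scalemxAl enormZ ger0_norm// ler_piMr//.
    by apply: KL; rewrite mulKVmx.
  by move=> A t /le_int[].
move=> _ [A [t [[fA mA] ->]]].
have f0 : lowner_feasible \1_K A0 n%:R.
  apply/lowner_feasible_indic; split=> // x Kx.
  rewrite /affine_app/= addr0 -scalemxAl enormZ ger0_norm// ler_piMr//.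
  by apply: KL; rewrite mulKVmx.
have [_ /(_ (mA _ _ f0))[tn dn]] := le_int _ _ fA.
have [uA t0 hA tb] := feas _ _ fA; subst t.
have uM : linpart A *m L \in unitmx by rewrite unitmx_mul uA.
have [_ /(_ uM dn) MM] := trace_bounded_det tb.
set M := linpart A *m L in hA MM; set o := offset A in hA.
have lin (N x y z : R) : z + y + (y + x) <= N -> z + 2 * y <= N - x by lra.
have lin' (k N x : R) : k * N <= k * (N - x) -> x * k <= 0 by lra.
(* The constraint expands to [n^2 |u|^2 + 2 <M^T o, u> <= n^2 - |o|^2], and the trace [n^3] is then
   at most [n (n^2 - |o|^2)]. *)
have o0 : dotv o o * n%:R <= 0.
  have := @minimal_ellipsoid_trace R n K L uL KL Lmin (n%:R ^+ 2)%:M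
    (2 *: (M^T *m o)) (n%:R ^+ 2 - dotv o o).
  rewrite mxtrace_scalar -[(n%:R ^+ 2) *+ n]mulr_natl => h.
  apply: (lin' _ (n%:R ^+ 2)).
  apply: h => u Ku; have := hA u Ku; rewrite enorm_le//.
  have e1 : dotv (M *m u) (M *m u) = n%:R ^+ 2 * dotv u u.
    by rewrite -!sqr_enorm (enorm_isotropic _ _ MM)// exprMn.
  rewrite mul_scalar_mx dotvZr dotvZl -dotv_mulmx -e1.
  rewrite (dotvDl (M *m u)) !dotvDr (dotvC (M *m u) o).
  exact: lin.
have {}o0 : o = 0.
  case: (posnP n) => [n0|n0]; first exact: eq_mx_dim0.
  apply/eqP; rewrite -dotv_eq0 eq_le dotv_ge0 andbT.
  by rewrite -(pmulr_lle0 _ (_ : 0 < n%:R)) ?ltr0n.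
(* The maps [A] and [A0] may differ by an isometry on the left; only the norms agree. *)
apply/funext => x; suff e : enorm (A x) = enorm (A0 x) by rewrite /exp_norm e.
have -> : A x = M *m (invmx L *m x).
  by rewrite /affine_app [offset A]o0 addr0 /M -mulmxA mulKVmx.
rewrite (enorm_isotropic _ _ MM)//.
by rewrite /A0 /affine_app /= addr0 -scalemxAl enormZ ger0_norm.
Qed.

(** The same chain with [t = - ln s] and [M = A^T L]. In the equality case
    [minimal_ellipsoid_center] removes the offset, and [A] is the candidate up to an orthogonal
    factor on the right, which preserves the ball. *)
Lemma john_fun_polar_indic :
  john_fun (polar \1_K) =
  scaled_indic (expR (- n%:R)) (AffineMap (n%:R *: invmx L^T) 0).
Proof.
set A0 := AffineMap _ _; set s0 := expR (- n%:R).
have uA0 : affine_invertible A0.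
  by rewrite /affine_invertible/= -trmx_inv -linearZ/= unitmx_tr.
have dL := detL_gt0 uL.
have d0E : `|\det (linpart A0)| = n%:R ^+ n / `|\det L|.
  rewrite /= -trmx_inv detZ det_tr det_inv normrM.
  by rewrite normrV ?unitfE -?normr_gt0// ger0_norm// ltW.
have f0 : john_feasible (polar \1_K) s0 A0.
  apply/john_feasible_polar_indic => //; split=> //; first exact: expR_gt0.
  move=> x Kx; rewrite /= dot0v addr0 -trmx_inv -linearZ/= trmxK /s0 expRK opprK.
  rewrite -scalemxAl enormZ ger0_norm// ler_piMr//.
  by apply: KL; rewrite mulKVmx.
have feas s (A : affine_map R n) : john_feasible (polar \1_K) s A ->
    [/\ 0 < s, affine_invertible A, 0 <= - ln s, forall u, K (L *m u) ->
        enorm ((linpart A)^T *m L *m u) + dotv (L^T *m offset A) u <= - ln s &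
      trace_bounded ((linpart A)^T *m L) (- ln s)].
  move=> /(john_feasible_polar_indic _ _ K0)[s_gt0 uA h].
  have h' u : K (L *m u) ->
      enorm ((linpart A)^T *m L *m u) + dotv (L^T *m offset A) u <= - ln s.
    by move=> Ku; rewrite -mulmxA -dotv_mulmx; exact: h.
  split=> //; last exact: john_trace_bounded h'.
  case: (posnP n) => [n0|n0].
    have [x Kx] := K0; apply: le_trans (h x Kx); rewrite addr_ge0 ?enorm_ge0//.
    by rewrite (eq_mx_dim0 x 0 n0) dotv0.
  (* The first-order condition with [G = 0] gives [0 <= n (- ln s)], which is conclusive only for
     [n > 0]. *)
  have := @minimal_ellipsoid_trace R n K L uL KL Lmin 0 (L^T *m offset A) (- ln s).
  rewrite mxtrace0 pmulr_rge0 ?ltr0n//; apply => u Ku.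
  by rewrite mul0mx dotv0 add0r (le_trans _ (h' u Ku))// lerDr enorm_ge0.
have le_val s A : john_feasible (polar \1_K) s A ->
    s * `|\det (linpart A)| <= s0 * `|\det (linpart A0)| /\
    (s0 * `|\det (linpart A0)| <= s * `|\det (linpart A)| ->
     - ln s = n%:R /\ `|\det ((linpart A)^T *m L)| = n%:R ^+ n).
  move=> /feas [s_gt0 uA t0 _ tb]; have [dt _] := trace_bounded_det tb.
  have ht := @expr_le_expR R n _ t0; set t := - ln s in t0 tb dt ht *.
  have dAL : `|\det ((linpart A)^T *m L)| = `|\det (linpart A)| * `|\det L|.
    by rewrite det_mulmx det_tr normrM.
  pose c := s / `|\det L|.
  have c0 : 0 < c by rewrite divr_gt0.
  have -> : s * `|\det (linpart A)| = `|\det ((linpart A)^T *m L)| * c.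
    by rewrite dAL /c; field; rewrite gt_eqF.
  have -> : s0 * `|\det (linpart A0)| = expR (t - n%:R) * n%:R ^+ n * c.
    rewrite d0E /c expRD -/s0 /t expRN lnK//; move: (n%:R ^+ n) => N; field.
    by rewrite ?gt_eqF.
  rewrite !ler_pM2r//; split; first exact: le_trans dt ht.
  move=> kd; have /eqP := le_anti (introT andP (conj (ht.1) (le_trans kd dt))).
  rewrite ht.2 => /eqP tn; split=> //.
  apply: le_anti; rewrite -{1}tn dt/=.
  by move: kd; rewrite tn subrr expR0 mul1r.
apply: xget_unique.
  by exists s0, A0; split => //; split=> // s A /le_val[].
move=> _ [s [A [[fA mA] ->]]].
have [_ /(_ (mA _ _ f0))[sn dn]] := le_val _ _ fA.
have [s_gt0 uA t0 hA tb] := feas _ _ fA.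
have ss0 : s = s0 by rewrite /s0 -sn opprK lnK.
set M := (linpart A)^T *m L in dn hA tb.
have uM : M \in unitmx by rewrite unitmx_mul unitmx_tr uA.
have [_ ] := trace_bounded_det tb; rewrite sn => /(_ uM dn) MM.
have o0 : offset A = 0.
  have h u : K (L *m u) -> n%:R * enorm u + dotv (L^T *m offset A) u <= n%:R.
    by move=> Ku; rewrite -(enorm_isotropic _ _ MM)// -sn; exact: hA.
  have := minimal_ellipsoid_center uL KL Lmin (ler0n _ _) h.
  by move=> /(congr1 (mulmx (invmx L^T))); rewrite mulmx0 mulKmx ?unitmx_tr.
have [Q hQ MQ] := isotropic_scale MM.
have AE : linpart A = linpart A0 *m Q.
  rewrite /= -scalemxAl scalemxAr -MQ /M trmx_mul trmxK mulKmx ?unitmx_tr//.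
rewrite ss0; apply: eq_scaled_indic; apply/seteqP; split=> _ [v vB <-].
  exists (Q *m v); first by rewrite /eball/= orthogonal_enorm.
  by rewrite /affine_app o0 AE mulmxA.
exists (Q^T *m v); first by rewrite /eball/= orthogonal_enorm//; exact: orthogonal_mxT.
rewrite /affine_app o0 AE -!mulmxA (mulmxA Q); congr (_ *m _ + _).
by rewrite (mulmx1C hQ) mul1mx.
Qed.

End optimizers.

Theorem proposition4 (R : realType) (n : nat) (K : set 'cV[R]_n)
    (hK : convex_body K)
    (h0 : exists E, lowner_ellipsoid K E /\ ellipsoid_of_center 0 E) :
  polar (lowner_fun \1_K) = john_fun (polar \1_K).
Proof.
have [_ _ [x0 Kx0]] := hK; have {}Kx0 := interior_subset Kx0.
have [E [[_ KE Emin] [A [uA A0 EA]]]] := h0.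
have o0 : offset A = 0 by move: A0; rewrite /affine_app mulmx0 add0r.
pose L := linpart A.
have K0 : K !=set0 by exists x0.
have KL u : K (L *m u) -> enorm u <= 1.
  move=> /KE; rewrite EA => /(mem_affine_image _ uA).
  by rewrite o0 subr0 mulKmx.
(* Volumes are compared through determinants, after division by the finite positive volume of the
   ball. *)
have Lmin (B : affine_map R n) : affine_invertible B ->
    K `<=` B @` @eball R n ->
    `|\det L| <= `|\det (linpart B)|.
  move=> uB KB; have := Emin _ _ KB; rewrite EA !volume_affine//.
  have [v hv] := volume_eball_fin R n; have := volume_eball_gt0 R n.
  rewrite hv lte_fin -!EFinM lee_fin => v0 h.
  by rewrite -(ler_pM2r v0); apply: h; exists (B 0), B.
have uL : L \in unitmx by [].
rewrite (lowner_fun_indic uL K0 KL Lmin) (john_fun_polar_indic uL K0 KL Lmin).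
apply/funext => y; rewrite polar_exp_norm// /scaled_indic indicE.
(* The John ellipsoid is the ball of radius [n] of the norm [|L^T y|], the set where the polar of
   the Loewner function does not vanish. *)
have mem : ((AffineMap (n%:R *: invmx L^T) 0) @` @eball R n) y <->
    enorm (L^T *m y) <= n%:R.
  rewrite /affine_app/=; split=> [[v vB <-]|yn].
    rewrite addr0 -scalemxAl -scalemxAr mulKVmx ?unitmx_tr//.
    by rewrite enormZ ger0_norm// ler_piMr.
  exists (n%:R^-1 *: (L^T *m y)).
    rewrite /eball/= enormZ ger0_norm ?invr_ge0//.
    case: (posnP n) => [n0|n0]; first by rewrite [n in n%:R]n0 invr0 mul0r.
    by rewrite mulrC ler_pdivrMr ?ltr0n// mul1r.
  rewrite addr0 -scalemxAl -scalemxAr mulKmx ?unitmx_tr// scalerA.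
  case: (posnP n) => [n0|n0]; last by rewrite divff ?scale1r// pnatr_eq0 -lt0n.
  exact: eq_mx_dim0.
case: ifPn => yn; first by rewrite mem_set ?mulr1//; apply/mem.
by rewrite memNset ?mulr0// => /mem; apply/negP.
Qed.
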